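(* The compressed word problem for the free inverse monoid $\mathsf{FIM}(\{a\})$ of rank one can be solved in polynomial time. That is, the following decision problem is solvable in polynomial time: given two straight-line programs $\mathbb{A}$ and $\mathbb{B}$ over the alphabet $\{a, a^{-1}\}$, does $\mathsf{val}(\mathbb{A}) = \mathsf{val}(\mathbb{B})$ hold in $\mathsf{FIM}(\{a\})$?
   Context: Let $\Gamma = \{a\}$ and let $\Gamma^{-1} = \{a^{-1}\}$ be a disjoint copy of $\Gamma$. One sets $(a^{-1})^{-1} = a$ and $(a_1 \cdots a_n)^{-1} = a_n^{-1} \cdots a_1^{-1}$ for $a_i \in \Gamma \cup \Gamma^{-1}$. The free inverse monoid generated by $\Gamma$ is $\mathsf{FIM}(\Gamma) = (\Gamma \cup \Gamma^{-1})^*/\rho$, where $\rho$ is the smallest congruence on the free monoid $(\Gamma \cup \Gamma^{-1})^*$ containing, for all words $v,w \in (\Gamma \cup \Gamma^{-1})^*$, the pairs $(w, ww^{-1}w)$ and $(ww^{-1}vv^{-1}, vv^{-1}ww^{-1})$. Two words are equal in $\mathsf{FIM}(\Gamma)$ if they are congruent modulo $\rho$. A straight-line program (SLP) over a finite alphabet $\Sigma$ is a context-free grammar $\mathbb{A} = (V, \Sigma, S, P)$ with nonterminals $V$, terminals $\Sigma$, initial nonterminal $S \in V$ and productions $P \subseteq V \times (V \cup \Sigma)^*$ such that (i) for every $X \in V$ there is exactly one $\alpha \in (V \cup \Sigma)^*$ with $(X,\alpha) \in P$, and (ii) the relation $\{(X,Y) \in V \times V \mid (X,\alpha) \in P \text{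 for some } \alpha \text{ in which } Y \text{ occurs}\}$ has no cycle. Such a grammar generates exactly one word, denoted $\mathsf{val}(\mathbb{A}) \in \Sigma^*$. The size of $\mathbb{A}$ is $|\mathbb{A}| = \sum_{(X,\alpha) \in P} |\alpha|$. *)

(* Defs.v *)
From HB Require Import structures.
From Corelib Require Import BinNums.
From mathcomp Require Import all_boot.

Set Implicit Arguments.
Unset Strict Implicit.
Unset Printing Implicit Defensive.

(* [inl x] is the generator x, [inr x] its formal inverse. *)
Definition letter (G : Type) : Type := (G + G)%type.

Definition letter_inv G (x : letter G) : letter G :=
  match x with inl g => inr g | inr g => inl g end.

Definition word_inv G (w : seq (letter G)) : seq (letter G) :=
  rev (map (@letter_inv G) w).

(* The smallest congruence containing the defining pairs of FIM(G). *)
Inductive fim_eq (G : Type) : seq (letter G) -> seq (letter G) -> Prop :=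
| fim_idem w : fim_eq w (w ++ word_inv w ++ w)
| fim_comm v w : fim_eq (w ++ word_inv w ++ v ++ word_inv v)
                        (v ++ word_inv v ++ w ++ word_inv w)
| fim_refl u : fim_eq u u
| fim_sym u v : fim_eq u v -> fim_eq v u
| fim_trans u v w : fim_eq u v -> fim_eq v w -> fim_eq u w
| fim_cat u u' v v' : fim_eq u u' -> fim_eq v v' -> fim_eq (u ++ v) (u' ++ v').

(* Nonterminals are numbered, and the unique right-hand side of X is [rhs X]. *)
Record grammar (T : Type) := Grammar {
  nonterms : nat;
  start : 'I_nonterms;
  rhs : {ffun 'I_nonterms -> seq ('I_nonterms + T)} }.

Arguments start {T} g.
Arguments rhs {T} g.

Definition occurs_in (T : eqType) (g : grammar T) : rel 'I_(nonterms g) :=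
  fun X Y => inl Y \in rhs g X.

Definition acyclic (T : eqType) (g : grammar T) : Prop :=
  forall c : seq 'I_(nonterms g), c != [::] -> ~~ cycle (@occurs_in T g) c.

Record slp (T : eqType) := Slp {
  slp_grammar :> grammar T;
  slp_acyclic : acyclic slp_grammar }.

Section Derivation.
Variables (T : Type) (g : grammar T).
Implicit Types s t : seq ('I_(nonterms g) + T).

Inductive derives : seq ('I_(nonterms g) + T) -> seq ('I_(nonterms g) + T) -> Prop :=
| derives_refl s : derives s s
| derives_step u X v t :
    derives (u ++ rhs g X ++ v) t -> derives (u ++ inl X :: v) t.

Definition generates (w : seq T) : Prop := derives [:: inl (start g)] (map inr w).

Definition expand s : seq ('I_(nonterms g) + T) :=
  flatten [seq (match x with inl X => rhs g X | inr _ => [:: x] end) | x <- s].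

Definition terminals s : seq T :=
  pmap (fun x => if x is inr a then Some a else None) s.

(* Parallel rewriting: if g is acyclic, no nonterminal is left after
   [nonterms g] rounds (see [slp_valP]). *)
Definition grammar_val : seq T :=
  terminals (iter (nonterms g) expand [:: inl (start g)]).

Lemma expand_cat s t : expand (s ++ t) = expand s ++ expand t.
Proof. by rewrite /expand map_cat flatten_cat. Qed.

Lemma iter_expand_cat k s t :
  iter k expand (s ++ t) = iter k expand s ++ iter k expand t.
Proof. by elim: k => //= k ->; rewrite expand_cat. Qed.

Lemma expand_terminal (w : seq T) : expand (map inr w) = map inr w.
Proof. by elim: w => //= a w {2}<-. Qed.

Lemma iter_expand_terminal k (w : seq T) : iter k expand (map inr w) = map inr w.
Proof. by elim: k => //= k ->; rewrite expand_terminal. Qed.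

Lemma derives_trans s t u : derives s t -> derives t u -> derives s u.
Proof. by elim=> // v X w r _ IH ru; apply/derives_step/IH. Qed.

Lemma derives_expand_pre u s : derives (u ++ s) (u ++ expand s).
Proof.
elim: s u => [|[X|a] s IH] u; first exact: derives_refl.
- by apply: derives_step; rewrite !catA.
- by have := IH (rcons u (inr a)); rewrite !cat_rcons.
Qed.

Lemma derives_iter_expand k s : derives s (iter k expand s).
Proof.
elim: k => [|k IH]; first exact: derives_refl.
exact: derives_trans IH (derives_expand_pre [::] _).
Qed.

End Derivation.

Section SlpValue.
Variables (T : eqType) (A : slp T).
Notation N := (nonterms A).

Lemma iter_expand_path k X Y :
  inl Y \in iter k (@expand T A) [:: inl X] ->
  exists2 p, path (@occurs_in T A) X p & size p = k /\ last X p = Y.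
Proof.
elim: k Y => [|k IH] Y /=.
  by rewrite inE => /eqP[->]; exists [::].
case/flatten_mapP=> -[Z|a]; last by rewrite inE.
case/IH=> p pX [<- <-] oY; exists (rcons p Y).
  by rewrite rcons_path pX.
by rewrite size_rcons last_rcons.
Qed.

Lemma acyclic_path_uniq X p : path (@occurs_in T A) X p -> uniq (X :: p).
Proof.
elim: p X => // Y p IH X /[dup] pX /= /andP[_ pY].
rewrite -[_ && uniq p]/(uniq (Y :: p)) (IH Y pY) andbT; apply/negP => Xp.
case/splitPr: Xp pX => p1 p2.
rewrite cat_path /= => /andP[p1X /andP[lX _]].
have /negP[] := @slp_acyclic T A (X :: p1) isT.
by rewrite /cycle rcons_path p1X.
Qed.

Lemma iter_expand_nonterm X Y : inl Y \notin iter N (@expand T A) [:: inl X].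
Proof.
apply/negP => /iter_expand_path[p /acyclic_path_uniq Up [sp _]].
by have := max_card (mem (X :: p)); rewrite (card_uniqP Up) card_ord /= sp ltnn.
Qed.

Lemma iter_expand_val (s : seq ('I_N + T)) :
  iter N (@expand T A) s = map inr (terminals (iter N (@expand T A) s)).
Proof.
have: forall Y, inl Y \notin iter N (@expand T A) s.
  move=> Y; elim: s => [|[X|a] s IH]; first by rewrite (@iter_expand_terminal T A N [::]).
  - by rewrite -cat1s iter_expand_cat mem_cat negb_or iter_expand_nonterm.
  - by rewrite -cat1s iter_expand_cat (@iter_expand_terminal T A N [:: a]).
elim: (iter N _ s) => //= -[X|a] t IH nt.
  by have := nt X; rewrite inE eqxx.
by rewrite /= -IH // => Y; have := nt Y; rewrite inE negb_or => /andP[].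
Qed.

Lemma derives_iter_eq (s t : seq ('I_N + T)) :
  derives s t -> iter N (@expand T A) s = iter N (@expand T A) t.
Proof.
elim=> // u X v r _ <-; rewrite -[inl X :: v]cat1s !iter_expand_cat.
congr (_ ++ (_ ++ _)).
have <- : expand [:: inl X] = rhs A X by rewrite /expand /= cats0.
by rewrite -iterSr /= iter_expand_val expand_terminal.
Qed.

(* [grammar_val] is the unique word generated by a straight-line program. *)
Lemma slp_valP (w : seq T) : generates A w <-> w = grammar_val A.
Proof.
split=> [/derives_iter_eq|->].
  by rewrite iter_expand_terminal iter_expand_val => /inj_map <- // x y [].
rewrite /generates /grammar_val -iter_expand_val; exact: derives_iter_expand.
Qed.

End SlpValue.

Inductive token (T : Type) :=
| Terminal of T | Bit of bool | Nonterminal | Production | Separator.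

Arguments Bit {T}.
Arguments Nonterminal {T}.
Arguments Production {T}.
Arguments Separator {T}.

Section TokenFinite.
Variable T : Type.

Definition token_code (x : token T) : (T + bool + 'I_3)%type :=
  match x with
  | Terminal a => inl (inl a)
  | Bit b => inl (inr b)
  | Nonterminal => inr (inord 0)
  | Production => inr (inord 1)
  | Separator => inr (inord 2)
  end.

Definition token_decode (c : (T + bool + 'I_3)%type) : token T :=
  match c with
  | inl (inl a) => Terminal a
  | inl (inr b) => Bit b
  | inr i => nth Separator [:: Nonterminal; Production] i
  end.

Lemma token_codeK : cancel token_code token_decode.
Proof. by case=> //=; rewrite inordK. Qed.
End TokenFinite.

HB.instance Definition _ (T : finType) :=
  Finite.copy (token T) (can_type (@token_codeK T)).

(* Binary digits without leading zeros (none for 0), least significant first. *)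
Fixpoint pos_bits (p : positive) : seq bool :=
  match p with
  | xH => [:: true]
  | xO p => false :: pos_bits p
  | xI p => true :: pos_bits p
  end.

Definition bits (n : nat) : seq bool :=
  if bin_of_nat n is Npos p then pos_bits p else [::].

Section Encoding.
Variable T : Type.

Definition encode_nonterm (i : nat) : seq (token T) := Nonterminal :: map Bit (bits i).

Definition encode_symbol n (x : 'I_n + T) : seq (token T) :=
  match x with inl X => encode_nonterm X | inr a => [:: Terminal a] end.

Definition encode_rhs n (s : seq ('I_n + T)) : seq (token T) :=
  Production :: flatten (map (@encode_symbol n) s).

(* The start symbol, then the right-hand sides of X_0, X_1, ... in this order. *)
Definition encode_grammar (g : grammar T) : seq (token T) :=
  encode_nonterm (start g)
    ++ flatten [seq encode_rhs (rhs g X) | X <- enum 'I_(nonterms g)].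

End Encoding.

Definition encode_slp_pair (T : eqType) (AB : slp T * slp T) : seq (token T) :=
  encode_grammar AB.1 ++ Separator :: encode_grammar AB.2.

Section EncodingInjective.

Definition stops_at (U : Type) (p : pred U) (t : seq U) : bool :=
  if t is x :: _ then ~~ p x else true.

Lemma cat_stop_inj (U : Type) (p : pred U) s1 t1 s2 t2 :
  all p s1 -> all p s2 -> stops_at p t1 -> stops_at p t2 ->
  s1 ++ t1 = s2 ++ t2 -> s1 = s2 /\ t1 = t2.
Proof.
elim: s1 s2 => [|x s1 IH] [|y s2] //=; rewrite /stops_at.
- by case: t1 => // z t1 _ /andP[py _] /= npz _ [ez]; rewrite ez py in npz.
- by case: t2 {IH} => // z t2 /andP[px _] _ _ /= npz [ez]; rewrite -ez px in npz.
- move=> /andP[_ a1] /andP[_ a2] h1 h2 [-> e].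
  by have [-> ->] := IH _ a1 a2 h1 h2 e.
Qed.

Variable T : Type.

Definition is_bit (x : token T) := if x is Bit _ then true else false.
Definition not_production (x : token T) := if x is Production then false else true.
Definition not_separator (x : token T) := if x is Separator then false else true.

Lemma bits_inj : injective bits.
Proof.
move=> m n e; apply: (can_inj bin_of_natK); move: e; rewrite /bits.
have nil_pos p : pos_bits p <> [::] by case: p.
case: (bin_of_nat m) (bin_of_nat n) => [|p] [|q] // e; try by case: (nil_pos _ e).
  by case: (nil_pos _ (esym e)).
congr Npos; elim: p q e => [p IH|p IH|] [q|q|] //= [].
- by move/IH->.
- by move/nil_pos.
- by move/IH->.
- by move/esym/nil_pos.
Qed.

Lemma bits_cat_inj (m n : nat) (t1 t2 : seq (token T)) :
  stops_at is_bit t1 -> stops_at is_bit t2 ->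
  map Bit (bits m) ++ t1 = map Bit (bits n) ++ t2 -> m = n /\ t1 = t2.
Proof.
move=> h1 h2; have ab s : all is_bit (map Bit s) by elim: s.
case/(cat_stop_inj (ab _) (ab _) h1 h2) => e ->; split=> //.
by apply: bits_inj; apply: inj_map e => x y [].
Qed.

Lemma encode_symbols_inj n :
  injective (fun s : seq ('I_n + T) => flatten (map (@encode_symbol T n) s)).
Proof.
have stop s : stops_at is_bit (flatten (map (@encode_symbol T n) s)) by case: s => [|[]].
elim=> [|[X|a] s IH] [|[Y|b] t] //= [].
- by case/(bits_cat_inj (stop _) (stop _)) => /val_inj-> /IH->.
- by move=> -> /IH->.
Qed.

Lemma encode_rhss_inj n (f g : seq (seq ('I_n + T))) :
  flatten (map (@encode_rhs T n) f) = flatten (map (@encode_rhs T n) g) -> f = g.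
Proof.
have stop s : stops_at not_production (flatten (map (@encode_rhs T n) s)) by case: s.
have body s : all not_production (flatten (map (@encode_symbol T n) s)).
  by elim: s => //= -[X|a] s IH //=; rewrite all_cat IH andbT; elim: (bits X).
elim: f g => [|r f IH] [|s g] //= [].
by case/(cat_stop_inj (body _) (body _) (stop _) (stop _)) => /encode_symbols_inj-> /IH->.
Qed.

Lemma count_encode_rhss n (f : seq (seq ('I_n + T))) :
  count (predC not_production) (flatten (map (@encode_rhs T n) f)) = size f.
Proof.
have body s : count (predC not_production) (flatten (map (@encode_symbol T n) s)) = 0.
  by elim: s => //= -[X|a] s IH //=; rewrite count_cat IH addn0; elim: (bits X).
by elim: f => //= r f IH; rewrite count_cat body IH.
Qed.

Lemma encode_grammar_inj : injective (@encode_grammar T).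
Proof.
case=> [n S r] [m S' r']; rewrite /encode_grammar /= => -[].
have stop k (q : 'I_k -> seq ('I_k + T)) :
  stops_at is_bit (flatten [seq encode_rhs (q X) | X <- enum 'I_k]) by case: (enum _).
case/(bits_cat_inj (stop n r) (stop m r')) => eS e.
have emap k (q : 'I_k -> seq ('I_k + T)) :
    [seq encode_rhs (q X) | X <- enum 'I_k] = map (@encode_rhs T k) (map q (enum 'I_k)).
  by rewrite -map_comp.
rewrite !emap in e.
have enm : n = m.
  have := congr1 (count (predC not_production)) e.
  by rewrite !count_encode_rhss !(size_map _ (enum _)) !size_enum_ord.
case: m / enm S' r' eS e => S' r' /val_inj <- /encode_rhss_inj e.
by congr Grammar; apply/ffunP => X; move/eq_in_map: e; apply; rewrite mem_enum.
Qed.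

Lemma all_not_separator (g : grammar T) : all not_separator (encode_grammar g).
Proof.
have nt i : all not_separator (@encode_nonterm T i) by rewrite /=; elim: (bits i).
rewrite /encode_grammar all_cat nt; elim: (enum _) => //= X s IH.
rewrite all_cat IH andbT; elim: (rhs g X) => //= -[Y|a] t {}IH //=.
by rewrite all_cat IH andbT; apply: nt Y.
Qed.

End EncodingInjective.

Lemma encode_slp_pair_inj (T : eqType) (AB AB' : slp T * slp T) :
  encode_slp_pair AB = encode_slp_pair AB' ->
  slp_grammar AB.1 = slp_grammar AB'.1 /\ slp_grammar AB.2 = slp_grammar AB'.2.
Proof.
move=> e; have [] := cat_stop_inj (all_not_separator _) (all_not_separator _) _ _ e => //.
by move=> /encode_grammar_inj-> /(congr1 behead) /encode_grammar_inj->.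
Qed.

Inductive direction := MoveLeft | Stay | MoveRight.

(* The tape alphabet consists of the blank [None], the input symbols and
   finitely many work symbols. *)
Record turing_machine (I : finType) := TuringMachine {
  tm_state : finType;
  tm_work : finType;
  tm_extra_tapes : nat;
  tm_cell := option (I + tm_work);
  tm_start : tm_state;
  (* [None]: not halting; [Some true]: accepting; [Some false]: rejecting *)
  tm_verdict : tm_state -> option bool;
  tm_delta : tm_state -> {ffun 'I_tm_extra_tapes.+1 -> tm_cell} ->
             tm_state * {ffun 'I_tm_extra_tapes.+1 -> tm_cell * direction} }.

(* A two-way infinite tape: the part left of the head (nearest cell first), the
   scanned cell, the part right of the head; all other cells are blank. *)
Record tape (C : Type) := Tape { tape_left : seq C; tape_head : C; tape_right : seq C }.

Section Tapes.
Variables (C : Type) (blank : C).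

Definition tape_of (s : seq C) : tape C := Tape [::] (head blank s) (behead s).

Definition tape_update (t : tape C) (a : C * direction) : tape C :=
  let: Tape l _ r := t in
  match a.2 with
  | MoveLeft => Tape (behead l) (head blank l) (a.1 :: r)
  | Stay => Tape l a.1 r
  | MoveRight => Tape (a.1 :: l) (head blank r) (behead r)
  end.
End Tapes.

Section Run.
Variables (I : finType) (M : turing_machine I).

Definition tm_config : Type :=
  tm_state M * {ffun 'I_(tm_extra_tapes M).+1 -> tape (tm_cell M)}.

Definition tm_init (w : seq I) : tm_config :=
  (tm_start M,
   [ffun i => tape_of None (if i == ord0 then [seq Some (inl x) | x <- w] else [::])]).

Definition tm_step (c : tm_config) : tm_config :=
  if tm_verdict c.1 is Some _ then c else
  let: (q, a) := tm_delta c.1 [ffun i => tape_head (c.2 i)] in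
  (q, [ffun i => tape_update None (c.2 i) (a i)]).

Definition tm_verdict_within (t : nat) (w : seq I) : option bool :=
  tm_verdict (iter t tm_step (tm_init w)).1.

End Run.

Definition polytime_decidable (I : finType) (L : seq I -> Prop) : Prop :=
  exists (M : turing_machine I) (c d : nat), forall w : seq I,
    exists2 b : bool,
      tm_verdict_within M (c * size w ^ d + c) w = Some b & b <-> L w.

(* Decidability of the language of (encodings of) yes-instances: in particular,
   strings that do not encode an instance have to be rejected. *)
Definition polytime_solvable (X : Type) (I : finType)
    (encode : X -> seq I) (P : X -> Prop) : Prop :=
  polytime_decidable (fun w => exists2 x : X, encode x = w & P x).

Definition compressed_equal (G : eqType) (AB : slp (letter G) * slp (letter G)) : Prop :=
  fim_eq (grammar_val AB.1) (grammar_val AB.2).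

(* Main.v *)
(* A word over {a, a^-1} is a walk on the integers, and in FIM({a}) it is determined
   by the minimum, the maximum and the end point of the walk.  The triple is encoded
   by a pair of elements of the bicyclic monoid, so that concatenation only needs
   addition and truncated subtraction of natural numbers: FIM({a}) embeds into the
   square of the bicyclic monoid.

   For straight-line programs these numbers are at most exponential, so their binary
   representations are computed in polynomial time.  Starting from an empty table of
   values of the nonterminals, all right-hand sides are evaluated n times in parallel,
   where n is the number of nonterminals.  After k rounds the entry of X is defined if
   and only if k rounds of parallel rewriting remove all nonterminals from X; so after
   n rounds all entries are defined if and only if the grammar is acyclic and mentions
   existing nonterminals only, which also decides the validity of the input.

   Turing machines are obtained from a class [polyf] of functions on data coded by
   binary trees, closed under composition, pairing, case distinction and folding over
   lists with polynomially bounded accumulators.  Trees are kept in preorder on one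
   tape used as a stack, so a function is a program acting on the top of the stack. *)

Require Import Defs.
From Corelib Require Import PosDef.
From mathcomp Require Import all_boot zify.
From Stdlib Require Import Setoid Morphisms.

Set Implicit Arguments.
Unset Strict Implicit.
Unset Printing Implicit Defensive.

(** * Stack programs and Turing machines *)

Section Programs.
Variables (I W : finType) (n : nat).
Notation sym := (I + W)%type.
Notation cell := (option sym).
Notation reg := 'I_n.+1.

(** Each register is a tape used as a stack. Tests see only the topmost symbol ([None] for an empty
    stack), so that finite control suffices. *)
Inductive cmd :=
| Skip
| Pop of reg
| Push of reg & sym
| Seq of cmd & cmd
| Switch of reg & (cell -> cmd)
| While of reg & pred cell & cmd.

Notation mem := (seq (seq sym)).

(** The number is an upper bound on machine steps: [exec_le] allows weakening it. [Push] costs 2,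
    one step to move left and one to write. *)
Inductive exec : cmd -> mem -> nat -> mem -> Prop :=
| exec_skip m : exec Skip m 1 m
| exec_pop (i : reg) m : exec (Pop i) m 1 (set_nth [::] m i (behead (nth [::] m i)))
| exec_push (i : reg) x m : exec (Push i x) m 2 (set_nth [::] m i (x :: nth [::] m i))
| exec_seq c1 c2 m1 m2 m3 t1 t2 :
    exec c1 m1 t1 m2 -> exec c2 m2 t2 m3 -> exec (Seq c1 c2) m1 (t1 + t2) m3
| exec_switch (i : reg) f m m' t :
    exec (f (ohead (nth [::] m i))) m t m' -> exec (Switch i f) m t.+1 m'
| exec_while_stop (i : reg) (p : pred cell) c m :
    ~~ p (ohead (nth [::] m i)) -> exec (While i p c) m 1 m
| exec_while_next (i : reg) (p : pred cell) c m1 m2 m3 t1 t2 :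
    p (ohead (nth [::] m1 i)) -> exec c m1 t1 m2 -> exec (While i p c) m2 t2 m3 ->
    exec (While i p c) m1 (t1 + t2).+1 m3
| exec_le c m t t' m' : t <= t' -> exec c m t m' -> exec c m t' m'.

(** Control points become machine states. A [Switch] has finitely many branches because cells form a
    finite type. *)
Fixpoint point (c : cmd) : finType :=
  match c with
  | Skip => unit
  | Pop _ => unit
  | Push _ _ => bool
  | Seq c1 c2 => (point c1 + point c2)%type
  | Switch i f => option {x : cell & point (f x)}
  | While _ _ c => option (point c)
  end.

Fixpoint entry (c : cmd) : point c :=
  match c with
  | Skip => tt
  | Pop _ => tt
  | Push _ _ => false
  | Seq c1 c2 => inl (entry c1)
  | Switch i f => None
  | While _ _ c => None
  end.

Definition action := option (reg * (cell * direction)).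

(** A successor [None] means that the program ends with this step. Each step acts on at most one
    tape. *)
Fixpoint next_point (c : cmd) :
    point c -> {ffun reg -> cell} -> option (point c) * action :=
  match c with
  | Skip => fun _ _ => (None, None)
  | Pop i => fun _ _ => (None, Some (i, (None, MoveRight)))
  | Push i x => fun s h =>
      if s then (None, Some (i, (Some x, Stay)))
      else (Some true, Some (i, (h i, MoveLeft)))
  | Seq c1 c2 => fun s h =>
      match s with
      | inl s1 => let: (s', a) := next_point s1 h in
                  (Some (if s' is Some s1' then inl s1' else inr (entry c2)), a)
      | inr s2 => let: (s', a) := next_point s2 h in (omap inr s', a)
      end
  | Switch i f => fun s h =>
      match s with
      | None => (Some (Some (Tagged (fun x => point (f x)) (entry (f (h i))))), None)
      | Some (existT x s1) =>
          let: (s', a) := next_point s1 h in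
          (omap (fun s2 => Some (Tagged (fun x => point (f x)) s2)) s', a)
      end
  | While i p c => fun s h =>
      match s with
      | None => (if p (h i) then Some (Some (entry c)) else None, None)
      | Some s1 => let: (s', a) := next_point s1 h in (Some s', a)
      end
  end.

Notation tapes := ({ffun reg -> tape cell}).

Definition heads (tp : tapes) : {ffun reg -> cell} := [ffun i => tape_head (tp i)].

Definition act (a : action) (h : {ffun reg -> cell}) : {ffun reg -> cell * direction} :=
  [ffun i => if a is Some (j, b) then if i == j then b else (h i, Stay)
             else (h i, Stay)].

Definition update (a : action) (tp : tapes) : tapes :=
  [ffun i => tape_update None (tp i) (act a (heads tp) i)].

Fixpoint runs c (s : point c) (tp : tapes) (t : nat) (tp' : tapes) : Prop :=
  if t is t'.+1 then
    let: (s', a) := next_point s (heads tp) in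
    match s' with
    | None => t' = 0 /\ update a tp = tp'
    | Some s1 => runs s1 (update a tp) t' tp'
    end
  else False.

Lemma runs_seq c1 c2 (s : point c1) tp1 t1 tp2 t2 tp3 :
  runs s tp1 t1 tp2 -> runs (entry c2) tp2 t2 tp3 ->
  @runs (Seq c1 c2) (inl s) tp1 (t1 + t2) tp3.
Proof.
have inr_runs (s' : point c2) t tp tp' :
    runs s' tp t tp' -> @runs (Seq c1 c2) (inr s') tp t tp'.
  by elim: t s' tp => //= t IH s' tp; case: next_point => [[s''|] a] //= /IH.
move=> r1 r2; elim: t1 s tp1 r1 => //= t1 IH s tp1.
by case: next_point => [[s'|] a] /=; [apply: IH|case=> -> ->; apply: inr_runs].
Qed.

Lemma update_None tp : update None tp = tp.
Proof. by apply/ffunP => j; rewrite !ffunE; case: (tp j). Qed.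

Lemma runs_switch i (f : cell -> cmd) (tp : tapes) t tp' :
  runs (entry (f (tape_head (tp i)))) tp t tp' ->
  @runs (Switch i f) None tp t.+1 tp'.
Proof.
have br (y : cell) (s : point (f y)) tp1 :
    runs s tp1 t tp' ->
    @runs (Switch i f) (Some (Tagged (fun x => point (f x)) s)) tp1 t tp'.
  by elim: t s tp1 => //= t' IH s tp1; case: next_point => [[s'|] a] //= /IH.
by move=> /br r /=; rewrite ffunE update_None.
Qed.

Lemma runs_while i (p : pred cell) c (tp1 : tapes) t1 tp2 t2 tp3 :
  p (tape_head (tp1 i)) -> runs (entry c) tp1 t1 tp2 ->
  @runs (While i p c) None tp2 t2 tp3 ->
  @runs (While i p c) None tp1 (t1 + t2).+1 tp3.
Proof.
move=> ph r1 r2 /=; rewrite ffunE ph update_None.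
elim: t1 (entry c) tp1 r1 {ph} => //= t1 IH s tp1.
by case: next_point => [[s'|] a] /=; [apply: IH|case=> -> ->].
Qed.

(* Blanks left behind by pops stay on both sides of the stored stack. *)
Definition stores (t : tape cell) (s : seq sym) : Prop :=
  exists k j, tape_left t = nseq k None /\
    tape_head t :: tape_right t = map Some s ++ nseq j None.

Definition represents (tp : tapes) (m : mem) : Prop :=
  forall i, stores (tp i) (nth [::] m i).

Lemma stores_head t s : stores t s -> tape_head t = ohead s.
Proof. by case=> k [j [_]]; case: s => [|x s]; [case: j => // j|]; case. Qed.

Lemma stores_pop t s :
  stores t s -> stores (tape_update None t (None, MoveRight)) (behead s).
Proof.
case: t => l h r [k [j /= [-> e]]].
have [j' er] : exists j', r = map Some (behead s) ++ nseq j' None.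
  by case: s e => [|x s] /=; [case: j => // j [_ ->]; exists j|case=> _ ->; exists j].
exists k.+1; case: r er {e} => [|y r] e /=; last by exists j'; rewrite -e.
(* The head has left the recorded cells and scans a fresh blank, hence one trailing blank. *)
by exists 1; split=> //; case: (behead s) e.
Qed.

Lemma stores_push t s x : stores t s ->
  stores (tape_update None (tape_update None t (tape_head t, MoveLeft)) (Some x, Stay))
         (x :: s).
Proof.
(* [k.-1] also covers [k = 0], where the head enters a fresh blank on the left. *)
case: t => l h r [k [j /= [-> e]]]; exists k.-1, j; split; first by case: k.
by rewrite /= e.
Qed.

Lemma represents_update tp m i s t :
  represents tp m -> stores t s ->
  represents [ffun j => if j == i then t else tp j] (set_nth [::] m i s).
Proof.
move=> tpm ts j; rewrite ffunE nth_set_nth /= -val_eqE.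
by case: eqP => // _; apply: tpm.
Qed.

Lemma update_Some i b tp :
  update (Some (i, b)) tp =
  [ffun j => if j == i then tape_update None (tp i) b else tp j].
Proof.
by apply/ffunP => j; rewrite !ffunE; case: eqP => [->|_] //; case: (tp j).
Qed.

Lemma update_Some2 i a b tp :
  update (Some (i, b)) (update (Some (i, a)) tp) =
  [ffun j => if j == i then tape_update None (tape_update None (tp i) a) b else tp j].
Proof.
by rewrite !update_Some; apply/ffunP => j; rewrite !ffunE; case: eqP => // _; rewrite eqxx.
Qed.

(** Induction on the execution. The exact step count [t'] is only bounded by [t] because of
    [exec_le]. *)
Lemma exec_runs c m t m' : exec c m t m' -> forall tp, represents tp m ->
  exists t' tp', [/\ t' <= t, represents tp' m' & runs (entry c) tp t' tp'].
Proof.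
elim=> {c m t m'}
  [m|i m|i x m|c1 c2 m1 m2 m3 t1 t2 _ IH1 _ IH2|i f m m' t _ IH|i p c m ph
  |i p c m1 m2 m3 t1 t2 ph _ IH1 _ IH2|c m t t' m' tt' _ IH] tp tpm.
- by exists 1, tp; rewrite /= update_None.
- exists 1; eexists; split; [by []| |by split].
  by rewrite update_Some; apply: represents_update => //; apply: stores_pop.
- exists 2; eexists; split; [by []| |by split].
  rewrite ffunE update_Some2; apply: represents_update => //; exact: stores_push.
- have [t1' [tp1 [le1 r1 e1]]] := IH1 _ tpm.
  have [t2' [tp2 [le2 r2 e2]]] := IH2 _ r1.
  by exists (t1' + t2'), tp2; split; [lia| |apply: runs_seq e1 e2].
- have [t1 [tp1 [le1 r1 e1]]] := IH _ tpm.
  exists t1.+1, tp1; split=> //; apply: runs_switch.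
  by rewrite (stores_head (tpm i)).
- exists 1, tp; rewrite /= ffunE (stores_head (tpm i)) (negPf ph); split=> //.
  by rewrite update_None.
- have [t1' [tp1 [le1 r1 e1]]] := IH1 _ tpm.
  have [t2' [tp2 [le2 r2 e2]]] := IH2 _ r1.
  exists (t1' + t2').+1, tp2; split=> //; first by lia.
  by apply: runs_while e1 e2; rewrite (stores_head (tpm i)).
- have [t1 [tp1 [le1 r1 e1]]] := IH _ tpm.
  by exists t1, tp1; split=> //; lia.
Qed.

(* After [c], an extra step inspects the register [out] to reach a verdict. *)
Definition machine (c : cmd) (out : reg) (accept : pred cell) : turing_machine I :=
  @TuringMachine I (point c + option bool)%type W n (inl (entry c))
    (fun s => if s is inr v then v else None)
    (fun s h => match s with
       | inl s1 => let: (s', a) := next_point s1 h in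
                   (if s' is Some s2 then inl s2 else inr None, act a h)
       | inr _ => (inr (Some (accept (h out))), act None h)
       end).

Lemma machine_verdict c out accept (w : seq I) t T m' :
  exec c (map inl w :: nseq n [::]) t m' -> t < T ->
  tm_verdict_within (machine c out accept) T w =
    Some (accept (ohead (nth [::] m' out))).
Proof.
move=> ex ltT; set M := machine c out accept.
have init : represents (tm_init M w).2 (map inl w :: nseq n [::]).
  move=> i; rewrite ffunE -val_eqE; exists 0.
  case: i => -[|i] /= lti.
    by case: w {ex} => [|x w]; [exists 1|exists 0]; rewrite /= ?cats0 // -map_comp.
  by exists 1; rewrite nth_nseq if_same.
have [t' [tp' [let' rep' /= r]]] := exec_runs ex init.
have run (s : point c) tp : runs s tp t' tp' ->
    iter t' (@tm_step I M) (inl s, tp) = (inr None, tp').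
  elim: t' s tp {let' r} => // t1 IH s tp; rewrite iterSr /= /tm_step /=.
  rewrite -/(heads tp); case: next_point => [[s'|] a] /=.
    by move/IH <-.
  by case=> -> {IH} /= <-.
(* First [t'] steps of the program, then one step inspecting [out]; the remaining steps idle, as a
   halted configuration is a fixed point. *)
rewrite /tm_verdict_within; have -> : T = (T - t'.+1) + (1 + t') by lia.
rewrite iterD [iter (1 + _) _ _]iterD [tm_init M w]surjective_pairing run //=.
rewrite {2}/tm_step /= ffunE (stores_head (rep' out)).
set b := accept _; set tp := [ffun _ => _].
by rewrite iter_fix.
Qed.

End Programs.

(** * Programs on serialized trees *)

Inductive tree := Leaf | Node of tree & tree.

Fixpoint tree_size (t : tree) : nat :=
  if t is Node l r then (tree_size l + tree_size r).+1 else 1.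

Lemma tree_size_gt0 t : 0 < tree_size t. Proof. by case: t. Qed.

Section TreePrograms.
Variable I : finType.
Notation sym := (I + bool)%type.
Notation mem := (seq (seq sym)).
Notation prog := (cmd I bool 4).
Notation reg := 'I_5.
Notation exec := (@exec I bool 4).

Definition r0 : reg := Ordinal (isT : 0 < 5).
Definition r1 : reg := Ordinal (isT : 1 < 5).
Definition r2 : reg := Ordinal (isT : 2 < 5).
Definition r3 : reg := Ordinal (isT : 3 < 5).
Definition r4 : reg := Ordinal (isT : 4 < 5).

(** Preorder is self-delimiting: the tree on top of a stack can be taken off without an end
    marker. *)
Fixpoint ser (t : tree) : seq sym :=
  if t is Node l r then inr true :: ser l ++ ser r else [:: inr false].

Lemma size_ser t : size (ser t) = tree_size t.
Proof. by elim: t => //= l IHl r IHr; rewrite size_cat IHl IHr. Qed.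

(** Memories are treated as contexts with register [i] left open, so that one rule for [Pop] and one
    for [Push] serve all concrete register lists. *)
Definition hole (i : reg) (f : seq sym -> mem) :=
  forall s, nth [::] (f s) i = s /\ forall s', set_nth [::] (f s) i s' = f s'.

Lemma exec_pop_hole i f s : hole i f -> exec (Pop _ _ i) (f s) 1 (f (behead s)).
Proof. by move=> /(_ s)[h1 h2]; have := exec_pop i (f s); rewrite h2 h1. Qed.

Lemma exec_push_hole i x f s : hole i f -> exec (Push i x) (f s) 2 (f (x :: s)).
Proof. by move=> /(_ s)[h1 h2]; have := exec_push i x (f s); rewrite h2 h1. Qed.

(** A node replaces one pending subtree by two, so the counter grows by one; a leaf completes one,
    so it shrinks. *)
Definition pull_step (j : reg) : prog :=
  Switch r1 (fun x => if x is Some (inr b) then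
    Seq (Pop _ _ r1) (Seq (Push j (inr b)) (if b then Push r4 (inr true) else Pop _ _ r4))
  else Skip _ _ _).

Definition pull_loop j : prog := While r4 isSome (pull_step j).

(* Register 4 counts in unary the subtrees that are still to be moved. *)
Definition pull j : prog := Seq (Push r4 (inr true)) (pull_loop j).

Section Pull.
Variables (j : reg) (mm : seq sym -> seq sym -> seq sym -> mem).
Hypothesis h1 : forall y z, hole r1 (fun s => mm s y z).
Hypothesis hj : forall s z, hole j (fun y => mm s y z).
Hypothesis h4 : forall s y, hole r4 (mm s y).

Lemma pull_step_exec b s y z :
  exec (pull_step j) (mm (inr b :: s) y z) 6
    (mm s (inr b :: y) (if b then inr true :: z else behead z)).
Proof.
apply: exec_switch; rewrite (h1 y z _).1 /=.
apply: (@exec_le _ _ _ _ _ (1 + (2 + (if b then 2 else 1)))); first by case: b.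
apply: exec_seq; first exact: (exec_pop_hole _ (h1 y z)).
apply: exec_seq; first exact: (exec_push_hole _ _ (hj s z)).
case: b; [exact: (exec_push_hole _ _ (h4 _ _))|exact: (exec_pop_hole _ (h4 _ _))].
Qed.

(** The continuation of the loop is a hypothesis, so that the induction can chain the two subtrees
    of a node. Each symbol costs 6 steps for the body and 1 for the test. *)
Lemma pull_loop_exec t s y x z T m :
  exec (pull_loop j) (mm s (rev (ser t) ++ y) z) T m ->
  exec (pull_loop j) (mm (ser t ++ s) y (x :: z)) (7 * tree_size t + T) m.
Proof.
elim: t s y x z T => [|l IHl r IHr] s y x z T ex.
  apply: (@exec_while_next _ _ _ _ _ _ _ _ _ 6 T); first by rewrite (h4 _ _ _).1.
    exact: pull_step_exec.
  exact: ex.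
apply: (@exec_le _ _ _ _ _ (6 + (7 * tree_size l + (7 * tree_size r + T))).+1).
  by rewrite /=; lia.
rewrite /= -catA; apply: exec_while_next; first by rewrite (h4 _ _ _).1.
  exact: pull_step_exec.
apply: (IHl); apply: (IHr); move: ex.
by rewrite /= rev_cons -cats1 rev_cat -!catA.
Qed.

Lemma pull_exec t s y :
  exec (pull j) (mm (ser t ++ s) y [::]) (10 * tree_size t) (mm s (rev (ser t) ++ y) [::]).
Proof.
apply: (@exec_le _ _ _ _ _ (2 + (7 * tree_size t + 1))).
  by have := tree_size_gt0 t; lia.
apply: exec_seq; first exact: (exec_push_hole _ _ (h4 _ _)).
by apply: pull_loop_exec; apply: exec_while_stop; rewrite (h4 _ _ _).1.
Qed.
End Pull.

Definition dump (i j : reg) : prog :=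
  While i isSome (Switch i (fun x => if x is Some a then Seq (Pop _ _ i) (Push j a)
                                     else Skip _ _ _)).

Lemma dump_exec i j (mm : seq sym -> seq sym -> mem) s v y n :
  (forall y, hole i (fun s => mm s y)) -> (forall s, hole j (mm s)) ->
  rev s = v -> size v = n ->
  exec (dump i j) (mm s y) (6 * n).+1 (mm [::] (v ++ y)).
Proof.
move=> hi hj <- <-; rewrite size_rev; elim: s y => [|x s IH] y.
  by apply: exec_while_stop; rewrite (hi _ _).1.
apply: (@exec_le _ _ _ _ _ ((1 + 2).+1 + (6 * size s).+1).+1); first by rewrite /=; lia.
apply: exec_while_next; first by rewrite (hi _ _).1.
  apply: exec_switch; rewrite (hi _ _).1 /=.
  apply: exec_seq; first exact: (exec_pop_hole _ (hi y)).
  exact: (exec_push_hole _ _ (hj _)).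
by rewrite rev_cons -cats1 -catA; apply: IH.
Qed.

Definition copy : prog :=
  While r2 isSome (Switch r2 (fun x => if x is Some a then
    Seq (Pop _ _ r2) (Seq (Push r1 a) (Push r3 a)) else Skip _ _ _)).

Lemma copy_exec s y z :
  exec copy [:: [::]; s; y; z; [::]] (8 * size y).+1
    [:: [::]; rev y ++ s; [::]; rev y ++ z; [::]].
Proof.
elim: y s z => [|x y IH] s z; first exact: exec_while_stop.
apply: (@exec_le _ _ _ _ _ ((1 + (2 + 2)).+1 + (8 * size y).+1).+1).
  by rewrite /=; lia.
apply: exec_while_next => //.
  apply: exec_switch; apply: exec_seq; first exact: exec_pop.
  by apply: exec_seq; exact: exec_push.
by rewrite rev_cons -cats1 -!catA; apply: IH.
Qed.

Definition clear : prog := While r2 isSome (Pop _ _ r2).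

Lemma clear_exec s y :
  exec clear [:: [::]; s; y; [::]; [::]] (3 * size y).+1 [:: [::]; s; [::]; [::]; [::]].
Proof.
elim: y => [|x y IH]; first exact: exec_while_stop.
apply: (@exec_le _ _ _ _ _ (1 + (3 * size y).+1).+1); first by rewrite /=; lia.
by apply: exec_while_next => //; first exact: exec_pop.
Qed.

Definition main (s : seq sym) : mem := [:: [::]; s; [::]; [::]; [::]].

(** The rest [s] of the stack is arbitrary, which makes specifications stable under additional trees
    below ([does_cat]). *)
Definition does (c : prog) (t : nat) (ts ts' : seq tree) : Prop :=
  forall s, exec c (main (flatten (map ser ts) ++ s)) t (main (flatten (map ser ts') ++ s)).

Lemma does_le c t t' ts ts' : t <= t' -> does c t ts ts' -> does c t' ts ts'.
Proof. by move=> le_t dc s; apply: exec_le le_t (dc s). Qed.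

Lemma does_skip ts : does (Skip _ _ _) 1 ts ts.
Proof. by move=> s; apply: exec_skip. Qed.

Lemma does_seq c1 c2 t1 t2 ts1 ts2 ts3 :
  does c1 t1 ts1 ts2 -> does c2 t2 ts2 ts3 -> does (Seq c1 c2) (t1 + t2) ts1 ts3.
Proof. by move=> d1 d2 s; apply: exec_seq (d1 s) (d2 s). Qed.

Lemma does_cat c t ts1 ts2 ts : does c t ts1 ts2 -> does c t (ts1 ++ ts) (ts2 ++ ts).
Proof.
by move=> dc s; have := dc (flatten (map ser ts) ++ s); rewrite !map_cat !flatten_cat !catA.
Qed.

Definition drop_top : prog := Seq (pull r2) clear.

Lemma does_drop a ts : does drop_top (20 * tree_size a) (a :: ts) ts.
Proof.
move=> s; rewrite /= -catA.
apply: (@exec_le _ _ _ _ _ (10 * tree_size a + (3 * tree_size a).+1)).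
  by have := tree_size_gt0 a; lia.
apply: exec_seq; first by apply: (@pull_exec r2 (fun s y z => [:: [::]; s; y; [::]; z])).
by rewrite -size_ser -size_rev cats0; apply: clear_exec.
Qed.

(** The copy in register 3 has the right orientation and every transfer reverses it, so it returns
    to register 1 by way of register 2. *)
Definition dup : prog := Seq (pull r2) (Seq copy (Seq (dump r3 r2) (dump r2 r1))).

Lemma does_dup a ts : does dup (40 * tree_size a) (a :: ts) [:: a, a & ts].
Proof.
move=> s; rewrite /= -!catA.
apply: (@exec_le _ _ _ _ _
  (10 * tree_size a + ((8 * tree_size a).+1 + ((6 * tree_size a).+1 + (6 * tree_size a).+1)))).
  by have := tree_size_gt0 a; lia.
apply: exec_seq; first by apply: (@pull_exec r2 (fun s y z => [:: [::]; s; y; [::]; z])).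
have e : size (rev (ser a)) = tree_size a by rewrite size_rev size_ser.
apply: exec_seq; first by rewrite -e cats0; apply: copy_exec.
rewrite revK cats0; apply: exec_seq.
  by apply: (@dump_exec r3 r2 (fun z y => [:: [::]; ser a ++ _; y; z; [::]]) _ (rev (ser a))).
rewrite cats0.
by apply: (@dump_exec r2 r1 (fun z y => [:: [::]; y; z; [::]; [::]]) _ (ser a));
  rewrite ?revK ?size_ser.
Qed.

Definition swap : prog := Seq (pull r2) (Seq (pull r3) (Seq (dump r2 r1) (dump r3 r1))).

Lemma does_swap a b ts :
  does swap (20 * (tree_size a + tree_size b)) [:: a, b & ts] [:: b, a & ts].
Proof.
move=> s; rewrite /= -!catA.
apply: (@exec_le _ _ _ _ _
  (10 * tree_size a + (10 * tree_size b + ((6 * tree_size a).+1 + (6 * tree_size b).+1)))).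
  by have := tree_size_gt0 a; have := tree_size_gt0 b; lia.
apply: exec_seq; first by apply: (@pull_exec r2 (fun s y z => [:: [::]; s; y; [::]; z])).
apply: exec_seq.
  by apply: (@pull_exec r3 (fun s y z => [:: [::]; s; rev (ser a) ++ [::]; y; z])).
rewrite !cats0.
apply: exec_seq.
  by apply: (@dump_exec r2 r1 (fun z y => [:: [::]; y; z; rev (ser b); [::]]) _ (ser a));
    rewrite ?revK ?size_ser.
by apply: (@dump_exec r3 r1 (fun z y => [:: [::]; y; [::]; z; [::]]) _ (ser b));
  rewrite ?revK ?size_ser.
Qed.

(** Register 0, the input tape, is empty in [main] and serves as a third buffer. *)
Definition rot3 : prog :=
  Seq (pull r2) (Seq (pull r3) (Seq (pull r0)
    (Seq (dump r3 r1) (Seq (dump r0 r1) (dump r2 r1))))).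

Lemma does_rot3 a b c ts :
  does rot3 (20 * (tree_size a + tree_size b + tree_size c)) [:: a, b, c & ts] [:: a, c, b & ts].
Proof.
move=> s; rewrite /= -!catA.
apply: (@exec_le _ _ _ _ _
  (10 * tree_size a + (10 * tree_size b + (10 * tree_size c +
    ((6 * tree_size b).+1 + ((6 * tree_size c).+1 + (6 * tree_size a).+1)))))).
  by have := tree_size_gt0 a; have := tree_size_gt0 b; have := tree_size_gt0 c; lia.
apply: exec_seq; first by apply: (@pull_exec r2 (fun s y z => [:: [::]; s; y; [::]; z])).
apply: exec_seq.
  by apply: (@pull_exec r3 (fun s y z => [:: [::]; s; rev (ser a) ++ [::]; y; z])).
apply: exec_seq.
  by apply: (@pull_exec r0 (fun s y z => [:: y; s; rev (ser a) ++ [::]; rev (ser b) ++ [::]; z])).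
rewrite !cats0.
apply: exec_seq.
  by apply: (@dump_exec r3 r1 (fun z y => [:: rev (ser c); y; rev (ser a); z; [::]]) _ (ser b));
    rewrite ?revK ?size_ser.
apply: exec_seq.
  by apply: (@dump_exec r0 r1 (fun z y => [:: z; y; rev (ser a); [::]; [::]]) _ (ser c));
    rewrite ?revK ?size_ser.
by apply: (@dump_exec r2 r1 (fun z y => [:: [::]; y; z; [::]; [::]]) _ (ser a));
  rewrite ?revK ?size_ser.
Qed.

Definition cons_top : prog := Push r1 (inr true).

(** In preorder, pairing the two topmost trees amounts to pushing a single symbol. *)
Lemma does_cons a b ts : does cons_top 2 [:: a, b & ts] (Node a b :: ts).
Proof. by move=> s; rewrite /= -!catA; apply: exec_push. Qed.

Definition pop_top : prog := Pop _ _ r1.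

Lemma does_uncons a b ts : does pop_top 1 (Node a b :: ts) [:: a, b & ts].
Proof. by move=> s; rewrite /= -!catA; apply: exec_pop. Qed.

Lemma does_pop_leaf ts : does pop_top 1 (Leaf :: ts) ts.
Proof. by move=> s; apply: exec_pop. Qed.

Definition if_node (c1 c2 : prog) : prog :=
  Switch r1 (fun x => if x is Some (inr true) then c1 else c2).

Lemma does_if_node c1 c2 t ts1 ts2 :
  does (if nth Leaf ts1 0 is Node _ _ then c1 else c2) t ts1 ts2 -> ts1 <> [::] ->
  does (if_node c1 c2) t.+1 ts1 ts2.
Proof. by move=> dc ne s; apply: exec_switch; case: ts1 ne dc => [|[|? ?] ts] // _; apply. Qed.

Fixpoint push_tree (t : tree) : prog :=
  if t is Node l r then Seq (push_tree r) (Seq (push_tree l) (Push r1 (inr true)))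
  else Push r1 (inr false).

(** Register 0 is arbitrary because the reader pushes trees while input is still left there. *)
Lemma push_tree_exec t u s :
  exec (push_tree t) [:: u; s; [::]; [::]; [::]] (2 * tree_size t)
    [:: u; ser t ++ s; [::]; [::]; [::]].
Proof.
elim: t s => [|l IHl r IHr] s; first exact: exec_push.
apply: (@exec_le _ _ _ _ _ (2 * tree_size r + (2 * tree_size l + 2))).
  by rewrite /=; lia.
rewrite /= -catA; apply: exec_seq (IHr _) _; apply: exec_seq (IHl _) _.
exact: exec_push.
Qed.

Lemma does_push t ts : does (push_tree t) (2 * tree_size t) ts (t :: ts).
Proof. by move=> s; rewrite /= -catA; apply: push_tree_exec. Qed.

End TreePrograms.

(** * Polynomial-time functions *)

(** The base is at least 2, so constants and sums are absorbed by a larger exponent. *)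
Definition poly_bounded (p : nat -> nat) : Prop := exists d, forall n, p n <= (n + 2) ^ d.

Lemma leq_expl d m n : m <= n -> m ^ d <= n ^ d.
Proof. by case: d => // d mn; rewrite leq_exp2r. Qed.

Lemma poly_bounded_const c : poly_bounded (fun=> c).
Proof.
exists c => n; apply: (@leq_trans (2 ^ c)); first exact/ltnW/ltn_expl.
by apply: leq_expl; rewrite ?leq_addl.
Qed.

Lemma poly_bounded_id : poly_bounded id.
Proof. by exists 1 => n; rewrite expn1 leq_addr. Qed.

Lemma poly_bounded_mul p q :
  poly_bounded p -> poly_bounded q -> poly_bounded (fun n => p n * q n).
Proof. by case=> a pa [b qb]; exists (a + b) => n; rewrite expnD leq_mul. Qed.

Lemma poly_bounded_add p q :
  poly_bounded p -> poly_bounded q -> poly_bounded (fun n => p n + q n).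
Proof.
case=> a pa [b qb]; exists (a + b).+1 => n.
have h c d : (n + 2) ^ c <= (n + 2) ^ (c + d) by apply: leq_pexp2l; lia.
apply: (@leq_trans (2 * (n + 2) ^ (a + b))); last by rewrite expnS leq_mul // leq_addl.
have := h a b; have := h b a; rewrite [b + a]addnC; have := pa n; have := qb n; lia.
Qed.

Lemma poly_bounded_comp p q :
  poly_bounded p -> poly_bounded q -> poly_bounded (fun n => p (q n)).
Proof.
(* The exponent [b.+2] comes from $(n+2)^b + 2 \le (n+2)^{b+2}$. *)
case=> a pa [b qb]; exists (b.+2 * a) => n; rewrite expnM.
apply: leq_trans (pa _) _; apply: leq_expl.
apply: (@leq_trans ((n + 2) ^ b + 2)); first by rewrite leq_add2r.
have h : 0 < (n + 2) ^ b by rewrite expn_gt0 addn2.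
by rewrite !expnS; nia.
Qed.

Ltac poly_bound :=
  lazymatch goal with
  | |- poly_bounded (fun n => @?p n + @?q n) =>
      apply: (@poly_bounded_add p q); poly_bound
  | |- poly_bounded (fun n => @?p n * @?q n) =>
      apply: (@poly_bounded_mul p q); poly_bound
  | |- poly_bounded (fun n => n) => exact: poly_bounded_id
  | |- poly_bounded (fun _ => ?c) => exact: (poly_bounded_const c)
  | |- poly_bounded (fun n => (?p (@?q n))) =>
      first [assumption | apply: (@poly_bounded_comp p q); [assumption|poly_bound]]
  | _ => try assumption
  end.

Structure enc_type := EncType { enc_sort :> Type; code : enc_sort -> tree }.

Canonical enc_unit := EncType (fun _ : unit => Leaf).
Canonical enc_bool := EncType (fun b : bool => if b then Node Leaf Leaf else Leaf).
Canonical enc_prod (A B : enc_type) :=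
  EncType (fun p : A * B => Node (code p.1) (code p.2)).
Canonical enc_sum (A B : enc_type) := EncType (fun s : A + B =>
  match s with
  | inl a => Node (code false) (code a)
  | inr b => Node (code true) (code b)
  end).
Canonical enc_option (A : enc_type) :=
  EncType (fun o : option A => if o is Some a then Node Leaf (code a) else Leaf).
Canonical enc_seq (A : enc_type) :=
  EncType (fix enc (s : seq A) := if s is a :: s' then Node (code a) (enc s') else Leaf).

Definition sz (A : enc_type) (a : A) : nat := tree_size (code a).

Arguments sz : simpl never.

Lemma sz_pair (A B : enc_type) (a : A) (b : B) : sz (a, b) = (sz a + sz b).+1.
Proof. by []. Qed.

Lemma sz_cons (A : enc_type) (a : A) s : sz (a :: s) = (sz a + sz s).+1.
Proof. by []. Qed.

Lemma sz_gt0 (A : enc_type) (a : A) : 0 < sz a.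
Proof. exact: tree_size_gt0. Qed.

(** Pattern matching is named by combinators, which [polyf_tac] can recognise syntactically. *)
Definition case_seq A B (s : seq A) (b : B) (f : A * seq A -> B) : B :=
  if s is a :: s' then f (a, s') else b.
Definition case_option A B (s : option A) (b : B) (f : A -> B) : B :=
  if s is Some a then f a else b.
Definition case_sum A B C (s : A + B) (f : A -> C) (g : B -> C) : C :=
  match s with inl a => f a | inr b => g b end.

Section PolyFun.
Variable I : finType.
Notation prog := (cmd I bool 4).
Notation does := (@does I).

(** The output size is bounded along with the time, since in a composition it bounds the input of
    the second program. *)
Definition polyf (A B : enc_type) (f : A -> B) : Prop :=
  exists (c : prog) (d : nat), forall a, sz (f a) <= (sz a + 2) ^ d /\
    does c ((sz a + 2) ^ d) [:: code a] [:: code (f a)].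

Section Basics.
Variables A B : enc_type.

Lemma polyf_intro c T S (f : A -> B) : poly_bounded T -> poly_bounded S ->
  (forall a, sz (f a) <= S (sz a)) ->
  (forall a, does c (T (sz a)) [:: code a] [:: code (f a)]) -> polyf f.
Proof.
move=> pT pS hs hc; have [d hd] := poly_bounded_add pT pS.
exists c, d => a; have /= hda := hd (sz a); have hsa := hs a; split; first by lia.
by apply: does_le (hc a); lia.
Qed.

Lemma polyf_elim (f : A -> B) : polyf f -> exists c p,
  [/\ poly_bounded p, {homo p : m n / m <= n},
      forall a, sz (f a) <= p (sz a) &
      forall a, does c (p (sz a)) [:: code a] [:: code (f a)]].
Proof.
case=> c [d h]; exists c, (fun n => (n + 2) ^ d); split.
- by exists d.
- by move=> m n mn; apply: leq_expl; rewrite leq_add2r.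
- by move=> a; case: (h a).
- by move=> a; case: (h a).
Qed.

Lemma eq_polyf (f g : A -> B) : f =1 g -> polyf f -> polyf g.
Proof. by move=> fg [c [d h]]; exists c, d => a; rewrite -fg. Qed.

(** Covers constructors such as [cons], [Some], [inl] and [inr], whose results have the same code as
    a suitable pair. *)
Lemma polyf_recode (f : A -> B) : (forall a, code (f a) = code a) -> polyf f.
Proof.
move=> e; apply: (@polyf_intro (Skip _ _ _) (fun=> 1) id).
- exact: poly_bounded_const.
- exact: poly_bounded_id.
- by move=> a; rewrite /sz e.
- by move=> a; rewrite e; apply: does_skip.
Qed.

Lemma polyf_const (b : B) : polyf (fun _ : A => b).
Proof.
apply: (@polyf_intro (Seq (drop_top _) (push_tree _ (code b)))
  (fun n => 20 * n + 2 * sz b) (fun=> sz b)) => //; try poly_bound.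
by move=> a; apply: (does_seq (ts2 := [::])); [apply: does_drop|apply: does_push].
Qed.

End Basics.

Section Combinators.
Variables A B C X : enc_type.

Lemma polyf_comp (g : B -> C) (f : A -> B) :
  polyf g -> polyf f -> polyf (fun x => g (f x)).
Proof.
case/polyf_elim=> cg [pg [bg mg sg dg]] /polyf_elim[cf [pf [bf mf sf df]]].
apply: (@polyf_intro _ _ (Seq cf cg) (fun n => pf n + pg (pf n)) (fun n => pg (pf n))).
- by poly_bound.
- by poly_bound.
- by move=> a; apply: leq_trans (sg _) _; apply: mg.
- move=> a; apply: does_seq (df a) _; apply: does_le (dg _); exact: mg.
Qed.

Lemma polyf_pair (f : A -> B) (g : A -> C) :
  polyf f -> polyf g -> polyf (fun x => (f x, g x)).
Proof.
case/polyf_elim=> cf [pf [bf mf sf df]] /polyf_elim[cg [pg [bg mg sg dg]]].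
apply: (@polyf_intro _ _ (Seq (dup _) (Seq cf (Seq (swap _) (Seq cg (Seq (swap _) (cons_top _))))))
  (fun n => 40 * n + (pf n + (20 * (pf n + n) + (pg n + (20 * (pg n + pf n) + 2)))))
  (fun n => pf n + pg n + 1)).
- by poly_bound.
- by poly_bound.
- by move=> a; have := sf a; have := sg a; rewrite /sz /=; lia.
- move=> a; apply: does_seq (does_dup _ _) _.
  apply: does_seq; first by apply: (does_cat [:: code a] (df a)).
  apply: does_seq.
    by apply: does_le (does_swap _ _ _); have := sf a; rewrite /sz; lia.
  apply: does_seq; first by apply: (does_cat [:: code (f a)] (dg a)).
  apply: does_seq; last exact: does_cons.
  by apply: does_le (does_swap _ _ _); have := sg a; have := sf a; rewrite /sz; lia.
Qed.

Lemma polyf_fst : polyf (fun x : A * B => x.1).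
Proof.
apply: (@polyf_intro _ _ (Seq (pop_top _) (Seq (swap _) (drop_top _)))
   (fun n => 1 + (20 * n + 20 * n)) id); try poly_bound.
- by case=> a b; rewrite /sz /=; lia.
- case=> a b; apply: does_seq (does_uncons _ _ _) _.
  apply: does_seq; first by apply: does_le (does_swap _ _ _); rewrite /sz /=; lia.
  by apply: does_le (does_drop _ _); rewrite /sz /=; lia.
Qed.

Lemma polyf_snd : polyf (fun x : A * B => x.2).
Proof.
apply: (@polyf_intro _ _ (Seq (pop_top _) (drop_top _)) (fun n => 1 + 20 * n) id).
- by poly_bound.
- by poly_bound.
- by case=> a b; rewrite /sz /=; lia.
- case=> a b; apply: does_seq (does_uncons _ _ _) _.
  by apply: does_le (does_drop _ _); rewrite /sz /=; lia.
Qed.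

(* [u] exhibits [A] as a type whose elements are coded like those of [option B],
   but without the tag. *)
Lemma polyf_untagged (u : A -> option B) (h : A -> X -> C) g f :
  polyf g -> polyf f ->
  (forall a x, match u a with
               | None => code a = Leaf /\ h a x = g x
               | Some b => [/\ code a = code b, code b <> Leaf & h a x = f (b, x)]
               end) ->
  polyf (fun p : A * X => h p.1 p.2).
Proof.
case/polyf_elim=> cg [pg [bg mg sg dg]] /polyf_elim[cf [pf [bf mf sf df]]] hu.
apply: (@polyf_intro _ _
  (Seq (pop_top _) (if_node (Seq (cons_top _) cf) (Seq (pop_top _) cg)))
  (fun n => 1 + (3 + (pf n + pg n))) (fun n => pf n + pg n)).
- by poly_bound.
- by poly_bound.
- case=> a x; case: (u a) (hu a x) => [b|] /= [].
    move=> e _ ->; have <- : sz (b, x) = sz (a, x) by rewrite !sz_pair /sz e.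
    exact: leq_trans (sf _) (leq_addr _ _).
  move=> _ ->; apply: leq_trans (sg _) (leq_trans (mg _ _ _) (leq_addl _ _)).
  by rewrite sz_pair; lia.
- case=> a x; apply: does_seq (does_uncons _ _ _) _ => /=.
  case: (u a) (hu a x) => [b|] [].
    move=> e nl ->; apply: (@does_le _ _ (2 + pf (sz (a, x))).+1); first by lia.
    apply: does_if_node => //; case ea: (code a) => [|y z] /=; first by case: nl; rewrite -e.
    rewrite -ea; apply: does_seq (does_cons _ _ _) _; rewrite e; have := df (b, x).
    by rewrite /sz /= -e.
  move=> e ->; apply: (@does_le _ _ (1 + pg (sz (a, x))).+1); first by lia.
  apply: does_if_node => //; rewrite e /=; apply: does_seq (does_pop_leaf _) _.
  by apply: does_le (dg _); apply: mg; rewrite /sz /=; lia.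
Qed.

End Combinators.

#[local] Arguments polyf_fst {A B}.
#[local] Arguments polyf_snd {A B}.

Section Derived.
Variables A B C X : enc_type.

Lemma polyf_case_seq (s : X -> seq A) (g : X -> C) (f : A * seq A -> X -> C) :
  polyf s -> polyf g -> polyf (fun p => f p.1 p.2) ->
  polyf (fun x => case_seq (s x) (g x) (fun p => f p x)).
Proof.
move=> ps pg pf.
apply: (polyf_comp (g := fun p : seq A * X => case_seq p.1 (g p.2) (fun q => f q p.2))
  _ (polyf_pair ps (polyf_recode (f := id) (fun=> erefl)))).
apply: (polyf_untagged (u := fun s => if s is a :: s' then Some (a, s') else None)
          (h := fun a x => case_seq a (g x) (fun q => f q x)) pg pf).
by case=> [|a l] x.
Qed.

Lemma polyf_case_option (s : X -> option A) (g : X -> C) (f : A -> X -> C) :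
  polyf s -> polyf g -> polyf (fun p => f p.1 p.2) ->
  polyf (fun x => case_option (s x) (g x) (fun p => f p x)).
Proof.
move=> ps pg pf.
apply: (polyf_comp (g := fun p : option A * X => case_option p.1 (g p.2) (fun q => f q p.2))
  _ (polyf_pair ps (polyf_recode (f := id) (fun=> erefl)))).
(* [Some a] has the code of [(tt, a)], so the untagged component has type [unit * A]. *)
have pf' : polyf (fun p : (unit * A) * X => f p.1.2 p.2).
  apply: (polyf_comp (g := fun p => f p.1 p.2) (f := fun p : (unit * A) * X => (p.1.2, p.2)) pf).
  apply: (polyf_pair (f := fun p => p.1.2) _ polyf_snd).
  exact: (polyf_comp polyf_snd polyf_fst).
apply: (polyf_untagged (u := omap (pair tt))
          (h := fun a x => case_option a (g x) (fun q => f q x)) pg pf').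
by case=> [a|] x.
Qed.

Lemma polyf_if (s : X -> bool) (f g : X -> C) :
  polyf s -> polyf f -> polyf g -> polyf (fun x => if s x then f x else g x).
Proof.
move=> ps pf pg.
apply: (polyf_comp (g := fun p : bool * X => if p.1 then f p.2 else g p.2)
  _ (polyf_pair ps (polyf_recode (f := id) (fun=> erefl)))).
(* [true] has the code of [(tt, tt)]. *)
apply: (polyf_untagged (u := fun b : bool => if b then Some (tt, tt) else None)
          (h := fun a x => if a then f x else g x) pg (polyf_comp pf polyf_snd)).
by case.
Qed.

Lemma polyf_case_sum (s : X -> A + B) (f : A -> X -> C) (g : B -> X -> C) :
  polyf s -> polyf (fun p => f p.1 p.2) -> polyf (fun p => g p.1 p.2) ->
  polyf (fun x => case_sum (s x) (fun a => f a x) (fun b => g b x)).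
Proof.
move=> ps /polyf_elim[cf [pf [bf mf sf df]]] /polyf_elim[cg [pg [bg mg sg dg]]].
apply: (polyf_comp (g := fun p : (A + B) * X =>
   case_sum p.1 (fun a => f a p.2) (fun b => g b p.2))
  _ (polyf_pair ps (polyf_recode (f := id) (fun=> erefl)))).
apply: (@polyf_intro _ _
  (Seq (pop_top _) (Seq (pop_top _) (if_node
    (* The tag of [inr] is a node with two leaves and takes three pops; that of [inl] is one
       leaf. *)
    (Seq (pop_top _) (Seq (pop_top _) (Seq (pop_top _) (Seq (cons_top _) cg))))
    (Seq (pop_top _) (Seq (cons_top _) cf)))))
  (fun n => 1 + (1 + (6 + (pf n + pg n)))) (fun n => pf n + pg n)).
- by poly_bound.
- by poly_bound.
- case=> -[a|b] x /=.
    apply: leq_trans (sf (a, x)) (leq_trans (mf _ _ _) (leq_addr _ _)).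
    by rewrite /sz /=; lia.
  apply: leq_trans (sg (b, x)) (leq_trans (mg _ _ _) (leq_addl _ _)).
  by rewrite /sz /=; lia.
- case=> s1 x; move eN: (sz _) => N; apply: does_seq (does_uncons _ _ _) _.
  case: s1 eN => [a|b] eN; (apply: does_seq; first exact: does_uncons).
    apply: (@does_le _ _ (1 + (2 + pf N)).+1); first by lia.
    apply: does_if_node => //.
    apply: does_seq (does_pop_leaf _) _; apply: does_seq (does_cons _ _ _) _.
    by apply: does_le (df (a, x)); apply: mf; rewrite -eN /sz /=; lia.
  apply: (@does_le _ _ (1 + (1 + (1 + (2 + pg N)))).+1); first by lia.
  apply: does_if_node => //.
  apply: does_seq (does_uncons _ _ _) _; do 2 apply: does_seq (does_pop_leaf _) _.
  apply: does_seq (does_cons _ _ _) _.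
  by apply: does_le (dg (b, x)); apply: mg; rewrite -eN /sz /=; lia.
Qed.

End Derived.

(** With list [a :: l] above accumulator [s], the stack passes through [a, l, s], then [a, s, l],
    then [(a, s), l], then the new accumulator above [l], and the final exchange restores the
    order. *)
Definition fold_loop (c : prog) : prog :=
  Seq (While r1 (pred1 (Some (inr true)))
         (Seq (pop_top _) (Seq (rot3 _) (Seq (cons_top _) (Seq c (swap _))))))
      (pop_top _).

(** [Q] bounds the accumulator after every prefix, so [L + Q + 1] bounds the argument of each call
    of [c]; [L] also bounds the number of calls. *)
Lemma fold_loop_does (A S : enc_type) (g : A * S -> S) c p (l : seq A) s Q L :
  {homo p : m n / m <= n} ->
  (forall y, does c (p (sz y)) [:: code y] [:: code (g y)]) ->
  (forall k, sz (foldl (fun s a => g (a, s)) s (take k l)) <= Q) -> sz l <= L ->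
  does (fold_loop c) (L * (p (L + Q + 1) + 40 * (L + Q) + 5) + 2)
    [:: code l; code s] [:: code (foldl (fun s a => g (a, s)) s l)].
Proof.
move=> mp dc; set K := p _ + _ + _ => hQ hL r.
suff ex : exec (While r1 (pred1 (Some (inr true)))
         (Seq (pop_top _) (Seq (rot3 _) (Seq (cons_top _) (Seq c (swap _))))))
    (main (ser I (code l) ++ ser I (code s) ++ r)) (sz l * K + 1)
    (main (inr false :: ser I (code (foldl (fun s a => g (a, s)) s l)) ++ r)).
  rewrite /= cats0 -!catA; apply: (@exec_le _ _ _ _ _ (sz l * K + 1 + 1)).
    by rewrite -addnA leq_add2r leq_mul2r hL orbT.
  by apply: exec_seq ex _; apply: exec_pop.
elim: l s hQ hL => [|a l IH] s hQ hL.
  apply: (@exec_le _ _ _ _ _ 1); first by rewrite leq_addl.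
  exact: exec_while_stop.
have hs : sz s <= Q by have := hQ 0.
have hs' : sz (g (a, s)) <= Q by have := hQ 1; rewrite /= take0.
have szl : sz (a :: l) = (sz a + sz l).+1 by [].
have step : does (Seq (pop_top I) (Seq (rot3 _) (Seq (cons_top _) (Seq c (swap _)))))
    K.-1 [:: code (a :: l); code s] [:: code l; code (g (a, s))].
  apply: (@does_le _ _ (1 + (20 * (L + Q) + (2 + (p (L + Q + 1) + 20 * (L + Q)))))).
    by rewrite /K; lia.
  apply: does_seq (does_uncons _ _ _) _.
  apply: does_seq.
    by apply: does_le (does_rot3 (code a) (code l) (code s) [::]);
      rewrite -!/(sz _); lia.
  apply: does_seq (does_cons _ _ _) _.
  apply: does_seq.
    apply: does_le (does_cat [:: code l] (dc (a, s))); apply: mp.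
    by rewrite sz_pair; lia.
  by apply: does_le (does_swap (code (g (a, s))) (code l) [::]); rewrite -!/(sz _); lia.
apply: (@exec_le _ _ _ _ _ (K.-1 + (sz l * K + 1)).+1).
  have K0 : 0 < K by rewrite /K; lia.
  by rewrite szl mulSn mulnDl; lia.
have := step r; rewrite /= !cats0 -!catA => ex.
apply: exec_while_next => //; first exact: ex.
apply: IH; last by lia.
by move=> k; apply: (hQ k.+1).
Qed.

Section Fold.
Variables A S X : enc_type.

Lemma polyf_foldl_bounded (l : X -> seq A) (i : X -> S) (g : S -> A -> X -> S) (P : nat -> nat) :
  polyf l -> polyf i -> polyf (fun p : S * A * X => g p.1.1 p.1.2 p.2) ->
  poly_bounded P ->
  (forall x k, sz (foldl (fun s a => g s a x) (i x) (take k (l x))) <= P (sz x)) ->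
  polyf (fun x => foldl (fun s a => g s a x) (i x) (l x)).
Proof.
move=> pl pi pg bP hP.
(* The parameter [x] travels with the accumulator, since the loop body sees nothing else. *)
pose g' (y : A * (S * X)) : S * X := (g y.2.1 y.1 y.2.2, y.2.2).
have e s m x : foldl (fun s a => g' (a, s)) (s, x) m = (foldl (fun s a => g s a x) s m, x).
  by elim: m s => //= a m IH s; rewrite -IH.
have pg' : polyf g'.
  apply: (polyf_pair (f := fun y => g y.2.1 y.1 y.2.2) _ (polyf_comp polyf_snd polyf_snd)).
  apply: (polyf_comp (g := fun p : S * A * X => g p.1.1 p.1.2 p.2)
    (f := fun y : A * (S * X) => (y.2.1, y.1, y.2.2)) pg).
  apply: (polyf_pair (f := fun y => (y.2.1, y.1)) _ (polyf_comp polyf_snd polyf_snd)).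
  exact: (polyf_pair (polyf_comp polyf_fst polyf_snd) polyf_fst).
have pid : polyf (fun x : X => x) by apply: polyf_recode.
suff pf : polyf (fun x => foldl (fun s a => g' (a, s)) (i x, x) (l x)).
  apply: eq_polyf (polyf_comp polyf_fst pf) => x; by rewrite e.
have [cl [p [bp mp _ dp]]] := polyf_elim (polyf_pair pl (polyf_pair pi pid)).
have [cg [q [bq mq _ dq]]] := polyf_elim pg'.
have [_ [pL [bL _ sL _]]] := polyf_elim pl.
pose Q n := P n + n + 1.
apply: (@polyf_intro _ _ (Seq cl (Seq (pop_top _) (fold_loop cg)))
  (fun n => p n + (1 + (pL n * (q (pL n + Q n + 1) + 40 * (pL n + Q n) + 5) + 2))) Q).
- by rewrite /Q; poly_bound.
- by rewrite /Q; poly_bound.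
- move=> x; rewrite e; have := hP x (size (l x)); rewrite take_size {1 3}/sz /=.
  by rewrite -!/(sz _) /Q; lia.
- move=> x; apply: does_seq (dp x) _; apply: does_seq (does_uncons _ _ _) _.
  apply: (fold_loop_does mq dq _ (sL x)) => k.
  by rewrite e {1}/sz /= -!/(sz _) /Q; have := hP x k; lia.
Qed.

(** The increment per step depends on the element and the parameter but not on the accumulator, so
    the increments add up and cannot compound. *)
Lemma polyf_foldl (l : X -> seq A) (i : X -> S) (g : S -> A -> X -> S) (K : nat -> nat) :
  polyf l -> polyf i -> polyf (fun p : S * A * X => g p.1.1 p.1.2 p.2) ->
  poly_bounded K -> {homo K : m n / m <= n} ->
  (forall s a x, sz (g s a x) <= sz s + K (sz a + sz x)) ->
  polyf (fun x => foldl (fun s a => g s a x) (i x) (l x)).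
Proof.
move=> pl pi pg bK mK hK.
have [_ [pL [bL _ sL _]]] := polyf_elim pl.
have [_ [pI [bI _ sI _]]] := polyf_elim pi.
apply: (@polyf_foldl_bounded _ _ _ (fun n => pI n + pL n * K (pL n + n))) => //.
  by poly_bound.
move=> x k; suff h s m : sz m <= pL (sz x) ->
    sz (foldl (fun s a => g s a x) s m) <= sz s + sz m * K (pL (sz x) + sz x).
  have tk : sz (take k (l x)) <= sz (l x).
    by elim: (l x) k => [|a m IH] [|k] //=; rewrite !sz_cons ltnS leq_add2l.
  have := h (i x) (take k (l x)) (leq_trans tk (sL x)).
  have := leq_mul (leq_trans tk (sL x)) (leqnn (K (pL (sz x) + sz x))).
  have := sI x; lia.
elim: m s => [|a m IH] s hm; first by rewrite leq_addr.
have sm : sz (a :: m) = (sz a + sz m).+1 by [].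
have := IH (g s a x); have := hK s a x.
have := mK (sz a + sz x) (pL (sz x) + sz x); rewrite /= sm; nia.
Qed.

End Fold.
End PolyFun.

(** * From polynomial-time functions to Turing machine deciders *)

Section Decision.
Variables (I : finType) (E : enc_type) (tok : I -> E).

Definition read_step : cmd I bool 4 :=
  Switch (r0 : 'I_5) (fun x => if x is Some (inl i) then
    Seq (Pop _ _ r0) (Seq (push_tree _ (code (tok i))) (Push r1 (inr true)))
  else Skip _ _ _).

Definition reader : cmd I bool 4 :=
  Seq (Push r1 (inr false)) (While r0 isSome read_step).

Definition read_cost := (2 * \max_(i : I) sz (tok i)) + 5.

Lemma read_cost_tok i : 2 * sz (tok i) + 5 <= read_cost.
Proof. by rewrite leq_add2r leq_mul2l /= (leq_bigmax i). Qed.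

(** Each token is put in front of the list read so far, so the word arrives reversed. *)
Lemma reader_exec w :
  exec reader (map inl w :: nseq 4 [::]) (read_cost * size w + 3)
    (main (ser I (code (rev (map tok w))))).
Proof.
rewrite addnC -[3]/(2 + 1) -addnA; apply: exec_seq; first exact: exec_push.
rewrite -[rev _]/(catrev (map tok w) [::]) /=.
have -> : [:: inr false] = ser I (code ([::] : seq E)) by [].
elim: w [::] => [|i w IH] l /=.
  by apply: (@exec_le _ _ _ _ _ 1) => //; apply: exec_while_stop.
apply: (@exec_le _ _ _ _ _ ((1 + (2 * sz (tok i) + 2)).+1 + (1 + read_cost * size w)).+1).
  by have := read_cost_tok i; rewrite mulnS; lia.
apply: exec_while_next (IH (tok i :: l)) => //.
apply: exec_switch => /=; apply: exec_seq; first exact: exec_pop.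
apply: exec_seq; first exact: push_tree_exec.
exact: exec_push.
Qed.

Lemma sz_read w : sz (rev (map tok w)) <= read_cost * size w + 1.
Proof.
suff h l : sz (catrev (map tok w) l) <= read_cost * size w + sz l by apply: (h [::]).
elim: w l => [|i w IH] l /=; first by rewrite leq_addl.
apply: leq_trans (IH _) _; rewrite sz_cons mulnS.
by have := read_cost_tok i; lia.
Qed.

Lemma polyf_decidable (f : seq E -> bool) (L : seq I -> Prop) :
  polyf I f -> (forall w, f (rev (map tok w)) <-> L w) -> polytime_decidable L.
Proof.
case/polyf_elim=> cf [p [bp mp _ dp]] fL.
have [d hd] : poly_bounded (fun n => read_cost * n + 3 + p (read_cost * n + 1)).
  by poly_bound.
(* $(n+2)^d$ is at most $3^d n^d$ for positive $n$ and at most $3^d$ for $n = 0$; the successor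
   yields the strict inequality required by [machine_verdict]. *)
exists (machine (Seq reader cf) r1 (pred1 (Some (inr true)))), (3 ^ d).+1, d => w.
exists (f (rev (map tok w))); last exact: fL.
have := dp (rev (map tok w)) [::]; rewrite [flatten _ ++ _]/= !cats0.
rewrite [flatten _]/= cats0 => /(exec_seq (reader_exec w)) ex.
rewrite (machine_verdict r1 _ ex) => [/=|]; first by case: (f _).
have lt : (size w + 2) ^ d <= (3 ^ d) * size w ^ d + 3 ^ d.
  case: (size w) => [|n]; last first.
    by apply: leq_trans (leq_addr _ _); rewrite -expnMn leq_expl //; lia.
  by apply: leq_trans (leq_addl _ _); apply: leq_expl.
have := hd (size w); have := mp _ _ (sz_read w).
have : 3 ^ d * size w ^ d <= (3 ^ d).+1 * size w ^ d by rewrite leq_mul2r leqnSn orbT.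
by lia.
Qed.

End Decision.

(** * The free inverse monoid of rank one *)

Section FreeInverseMonoid.
Variable G : Type.
Implicit Types (x : letter G) (w : seq (letter G)).

#[local] Instance fim_eq_equivalence : Equivalence (@fim_eq G).
Proof. split; [exact: fim_refl|exact: fim_sym|exact: fim_trans]. Qed.

#[local] Instance fim_eq_cat :
  Proper (@fim_eq G ==> @fim_eq G ==> @fim_eq G) (@cat (letter G)).
Proof. by move=> u u' uu' v v' vv'; apply: fim_cat. Qed.

Lemma letter_invK : involutive (@letter_inv G). Proof. by case. Qed.

Lemma word_inv_nseq n x : word_inv (nseq n x) = nseq n (letter_inv x).
Proof. by rewrite /word_inv map_nseq rev_nseq. Qed.

#[local] Hint Resolve fim_refl : core.

(* The idempotent of the walk that goes [n] steps in direction [x] and back. *)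
Definition excursion x n := nseq n x ++ nseq n (letter_inv x).

(** For [k <= q] this walk visits the positions from [- p] to [q], measured in direction [x], and
    ends at [k]. *)
Definition normal_word x p q k :=
  excursion (letter_inv x) p ++ excursion x q ++ nseq k x.

Lemma normal_word_cat x p q k w : normal_word x p q k ++ w =
  excursion (letter_inv x) p ++ excursion x q ++ nseq k x ++ w.
Proof. by rewrite /normal_word -!catA. Qed.

Lemma excursion_comm x m y n :
  fim_eq (excursion x m ++ excursion y n) (excursion y n ++ excursion x m).
Proof. by rewrite /excursion -!word_inv_nseq -!catA; apply: fim_comm. Qed.

Lemma excursion_pow x n : fim_eq (excursion x n ++ nseq n x) (nseq n x).
Proof. by rewrite /excursion -word_inv_nseq -catA; apply/fim_sym/fim_idem. Qed.

(** The longer excursion starts with [nseq m x], which absorbs the shorter one by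
    [excursion_pow]. *)
Lemma excursion_absorb x m n : m <= n ->
  fim_eq (excursion x n ++ excursion x m) (excursion x n).
Proof.
move=> mn; rewrite excursion_comm.
have -> : excursion x n = nseq m x ++ nseq (n - m) x ++ nseq n (letter_inv x).
  by rewrite catA -nseqD subnKC.
by rewrite [X in fim_eq X]catA excursion_pow.
Qed.

(** Writing $x^j = x^j x^{-j} x^j$ and commuting the idempotents $x^{-j} x^j$ and $x x^{-1}$ turns
    the detour into an excursion of length $j + 1$ in front, which the given one absorbs. *)
Lemma excursion_back x j n : j < n ->
  fim_eq (excursion x n ++ nseq j x ++ [:: x; letter_inv x]) (excursion x n ++ nseq j x).
Proof.
move=> jn.
have h : fim_eq (nseq j x ++ [:: x; letter_inv x]) (excursion x j.+1 ++ nseq j x).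
  rewrite -{1}(excursion_pow x j) /excursion -!catA.
  have -> : nseq j (letter_inv x) ++ nseq j x ++ [:: x; letter_inv x] =
    excursion (letter_inv x) j ++ excursion x 1 by rewrite /excursion letter_invK -catA.
  by rewrite excursion_comm /excursion letter_invK -[in nseq j.+1 x]addn1 nseqD -!catA.
by rewrite h catA excursion_absorb.
Qed.

Lemma normal_word_swap x p q :
  fim_eq (normal_word x p q 0) (normal_word (letter_inv x) q p 0).
Proof. by rewrite /normal_word letter_invK !cats0; apply: excursion_comm. Qed.

Lemma normal_word_forth x p q k : k <= q -> exists q' k', k' <= q' /\
  fim_eq (normal_word x p q k ++ [:: x]) (normal_word x p q' k').
Proof.
have e n : nseq n x ++ [:: x] = nseq n.+1 x by rewrite -addn1 nseqD.
rewrite leq_eqVlt => /orP[/eqP->|kq].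
  exists q.+1, q.+1; split=> //; rewrite normal_word_cat e.
  apply: fim_cat => //; rewrite [X in fim_eq _ X]excursion_pow -e.
  by rewrite catA excursion_pow.
by exists q, k.+1; rewrite normal_word_cat e.
Qed.

(** A backward step from a positive position stays inside the excursion. From position 0 the
    orientation is reversed, and the step becomes a forward one. *)
Lemma normal_word_rcons x p q k y : k <= q -> y = x \/ y = letter_inv x ->
  exists x' p' q' k', k' <= q' /\
    fim_eq (normal_word x p q k ++ [:: y]) (normal_word x' p' q' k').
Proof.
move=> kq [->|->].
  by have [q' [k' []]] := normal_word_forth x p kq; exists x, p, q', k'.
case: k kq => [|k] kq.
  have [p' [k' [le h]]] := normal_word_forth (letter_inv x) q (leq0n p).
  by exists (letter_inv x), q, p', k'; split=> //; rewrite normal_word_swap.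
exists x, p, q, k; split; first exact: ltnW.
rewrite normal_word_cat -addn1 nseqD -catA.
by apply: fim_cat => //; apply: excursion_back.
Qed.

End FreeInverseMonoid.

(** * The complete invariant in rank one *)

Notation word := (seq (letter unit)).

Lemma normal_word_exists (w : word) : exists x p q k, k <= q /\
  fim_eq w (normal_word x p q k).
Proof.
elim/last_ind: w => [|w y [x [p [q [k [kq h]]]]]].
  by exists (inl tt), 0, 0, 0; split=> //; apply: fim_refl.
(* Rank one enters here: any letter is [x] or its inverse. *)
have yx : y = x \/ y = letter_inv x.
  by case: x y {h} => -[] [] []; auto.
have [x' [p' [q' [k' [kq' h']]]]] := normal_word_rcons p kq yx.
exists x', p', q', k'; split=> //; rewrite -cats1.
exact: fim_trans (fim_cat h (fim_refl _)) h'.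
Qed.

(* [(u, v)] stands for the element [b^u c^v] of the bicyclic monoid [<b, c | cb = 1>]. *)
Definition bicyclic_mul (x y : nat * nat) := (x.1 + (y.1 - x.2), y.2 + (x.2 - y.1)).

Definition munn_mul (x y : (nat * nat) * (nat * nat)) :=
  (bicyclic_mul x.1 y.1, bicyclic_mul x.2 y.2).

(** The generator goes to the pair [(c, b)] and its inverse to [(b, c)]: the first factor records
    the depth below the start, the second the height above it. *)
Definition munn_letter (x : letter unit) : (nat * nat) * (nat * nat) :=
  if x is inl _ then ((0, 1), (1, 0)) else ((1, 0), (0, 1)).

(* If the walk [w] on the integers has minimum [- u], maximum [v] and end point [d],
   then its value is [((u, u + d), (v, v - d))]. *)
Definition munn (w : word) := foldr (fun x => munn_mul (munn_letter x)) ((0, 0), (0, 0)) w.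

Lemma munn_mulA : associative munn_mul.
Proof.
move=> [[? ?] [? ?]] [[? ?] [? ?]] [[? ?] [? ?]].
by rewrite /munn_mul /bicyclic_mul /=; congr ((_, _), (_, _)); lia.
Qed.

Lemma munn_mul1 x : munn_mul ((0, 0), (0, 0)) x = x.
Proof.
by case: x => [[? ?] [? ?]]; rewrite /munn_mul /bicyclic_mul /=;
  congr ((_, _), (_, _)); lia.
Qed.

Lemma munn_mulx1 x : munn_mul x ((0, 0), (0, 0)) = x.
Proof.
by case: x => [[? ?] [? ?]]; rewrite /munn_mul /bicyclic_mul /=;
  congr ((_, _), (_, _)); lia.
Qed.

Lemma munn_cat u v : munn (u ++ v) = munn_mul (munn u) (munn v).
Proof. by elim: u => [|x u /= ->]; rewrite ?munn_mul1 ?munn_mulA. Qed.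

Lemma munn_inv w : munn (word_inv w) =
  (((munn w).1.2, (munn w).1.1), ((munn w).2.2, (munn w).2.1)).
Proof.
elim: w => // x w IH; rewrite /word_inv /= rev_cons -cats1 munn_cat [munn (rev _)]IH.
case: (munn w) => [[? ?] [? ?]]; case: x => -[];
  by rewrite /munn_mul /bicyclic_mul /=; congr ((_, _), (_, _)); lia.
Qed.

Lemma munn_nseq n : munn (nseq n (inl tt)) = ((0, n), (n, 0)) /\
  munn (nseq n (inr tt)) = ((n, 0), (0, n)).
Proof.
elim: n => //= n [-> ->].
by split; rewrite /munn_mul /bicyclic_mul /=; congr ((_, _), (_, _)); lia.
Qed.

(** Reversing the orientation of a walk exchanges the two bicyclic factors. *)
Lemma munn_normal_word x p q k : k <= q -> munn (normal_word x p q k) =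
  if x is inl _ then ((p, p + k), (q, q - k)) else ((q, q - k), (p, p + k)).
Proof.
move=> kq; rewrite /normal_word /excursion letter_invK !munn_cat.
case: x => -[] /=; rewrite !(munn_nseq _).1 !(munn_nseq _).2;
  by rewrite /munn_mul /bicyclic_mul /=; congr ((_, _), (_, _)); lia.
Qed.

Lemma fim_eq_munn (u v : word) : fim_eq u v -> munn u = munn v.
Proof.
elim=> {u v} [w|v w|u|u v _ ->|u v w _ -> _ ->|u u' v v' _ hu _ hv] //.
  - rewrite !munn_cat munn_inv; case: (munn w) => [[? ?] [? ?]].
    by rewrite /munn_mul /bicyclic_mul /=; congr ((_, _), (_, _)); lia.
  - rewrite !munn_cat !munn_inv; case: (munn w) (munn v) => [[? ?] [? ?]] [[? ?] [? ?]].
    by rewrite /munn_mul /bicyclic_mul /=; congr ((_, _), (_, _)); lia.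
  - by rewrite !munn_cat hu hv.
Qed.

(** For completeness both words are brought to normal form, whose parameters can be read off from
    the value up to orientation. *)
Lemma fim_eqP (u v : word) : fim_eq u v <-> munn u = munn v.
Proof.
split; first exact: fim_eq_munn.
have [x [p [q [k [kq hu]]]]] := normal_word_exists u.
have [y [p' [q' [k' [kq' hv]]]]] := normal_word_exists v.
rewrite (fim_eq_munn hu) (fim_eq_munn hv) !munn_normal_word // => e.
apply: (fim_trans hu); apply: fim_trans (fim_sym hv).
case: x y e {hu hv} => -[] [[]|[]] [] *.
- have [-> -> ->] : [/\ p = p', q = q' & k = k'] by split; lia.
  exact: fim_refl.
(* Opposite orientations give equal values only if both walks end at the start. *)
- have [-> -> -> ->] : [/\ p = q', q = p', k = 0 & k' = 0] by split; lia.
  exact: normal_word_swap.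
- have [-> -> -> ->] : [/\ p = q', q = p', k = 0 & k' = 0] by split; lia.
  exact: normal_word_swap.
- have [-> -> ->] : [/\ p = p', q = q' & k = k'] by split; lia.
  exact: fim_refl.
Qed.

(** * Closure properties and automation for polynomial-time functions *)

Arguments polyf_fst {I A B}.
Arguments polyf_snd {I A B}.

Lemma polyf_id (I : finType) (A : enc_type) : polyf I (fun x : A => x).
Proof. exact: polyf_recode. Qed.

Lemma polyf_comp2 (I : finType) (A B C X : enc_type) (k : A -> B -> C) (f : X -> A) (g : X -> B) :
  polyf I (fun p => k p.1 p.2) -> polyf I f -> polyf I g -> polyf I (fun x => k (f x) (g x)).
Proof. by move=> pk pf pg; apply: (polyf_comp pk (polyf_pair pf pg)). Qed.

Lemma polyf_cons (I : finType) (A X : enc_type) (f : X -> A) (g : X -> seq A) :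
  polyf I f -> polyf I g -> polyf I (fun x => f x :: g x).
Proof.
move=> pf pg; apply: (polyf_comp2 (k := cons) _ pf pg).
exact: polyf_recode.
Qed.

Lemma polyf_Some (I : finType) (A X : enc_type) (f : X -> A) :
  polyf I f -> polyf I (fun x => Some (f x)).
Proof.
move=> pf; apply: (polyf_comp (g := fun p => Some p.2) (f := fun x => (tt, f x))).
  exact: polyf_recode.
exact: (polyf_pair (polyf_const _ _ _) pf).
Qed.

Lemma polyf_inl (I : finType) (A B X : enc_type) (f : X -> A) :
  polyf I f -> polyf I (fun x => inl (f x) : A + B).
Proof.
move=> pf; apply: (polyf_comp (g := fun p : unit * A => inl p.2 : A + B)
  (f := fun x => (tt, f x)) _ (polyf_pair (polyf_const _ _ _) pf)).
by apply: polyf_recode => -[[]].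
Qed.

Lemma polyf_inr (I : finType) (A B X : enc_type) (f : X -> B) :
  polyf I f -> polyf I (fun x => inr (f x) : A + B).
Proof.
move=> pf; apply: (polyf_comp (g := fun p : unit * unit * B => inr p.2 : A + B)
  (f := fun x => (tt, tt, f x)) _ (polyf_pair (polyf_const _ _ _) pf)).
by apply: polyf_recode => -[[]].
Qed.

Lemma polyf_bool (I : finType) (X C : enc_type) (h : bool -> C) (f : X -> bool) :
  polyf I f -> polyf I (fun x => h (f x)).
Proof.
move=> pf; apply: (@eq_polyf _ _ _ (fun x => if f x then h true else h false)).
  by move=> x; case: (f x).
by apply: polyf_if => //; apply: polyf_const.
Qed.

Lemma polyf_bool2 (I : finType) (X C : enc_type) (h : bool -> bool -> C) (f g : X -> bool) :
  polyf I f -> polyf I g -> polyf I (fun x => h (f x) (g x)).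
Proof.
move=> pf pg; apply: (@eq_polyf _ _ _ (fun x => if f x then h true (g x) else h false (g x))).
  by move=> x; case: (f x).
by apply: polyf_if => //; apply: polyf_bool.
Qed.

Definition case_bool C (b : bool) (x y : C) : C := if b then x else y.

Create HintDb polyf.

Ltac polyf_call :=
  first
  [ lazymatch goal with |- polyf _ (fun x => ?k (@?f x)) =>
      refine (polyf_comp (g := k) (f := f) _ _); [solve [assumption | auto with polyf nocore]|]
    end
  | lazymatch goal with |- polyf _ (fun x => ?k (@?f x) (@?g x)) =>
      refine (polyf_comp2 (k := k) (f := f) (g := g) _ _ _);
      [solve [assumption | auto with polyf nocore]| |]
    end ].

(** Follows the syntax of the function body; calls of other unary or binary functions are settled by
    assumptions or the hint database. *)
Ltac polyf_tac :=
  cbv beta;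
  lazymatch goal with
  | |- polyf _ (fun _ => ?c) => exact: polyf_const
  | |- polyf _ (fun x => x) => exact: polyf_id
  | |- polyf _ (fun x => (@?f x, @?g x)) =>
      refine (polyf_pair (f := f) (g := g) _ _); polyf_tac
  | |- polyf _ (fun x => fst (@?f x)) => refine (polyf_comp (f := f) polyf_fst _); polyf_tac
  | |- polyf _ (fun x => snd (@?f x)) => refine (polyf_comp (f := f) polyf_snd _); polyf_tac
  | |- polyf _ (fun x => @?f x :: @?g x) =>
      refine (polyf_cons (f := f) (g := g) _ _); polyf_tac
  | |- polyf _ (fun x => Some (@?f x)) => refine (polyf_Some (f := f) _); polyf_tac
  | |- polyf _ (fun x => inl (@?f x)) => refine (@polyf_inl _ _ _ _ f _); polyf_tac
  | |- polyf _ (fun x => inr (@?f x)) => refine (@polyf_inr _ _ _ _ f _); polyf_tac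
  | |- polyf _ (fun x => case_bool (@?b x) (@?f x) (@?g x)) =>
      refine (polyf_if (s := b) (f := f) (g := g) _ _ _); polyf_tac
  | |- polyf _ (fun x => andb (@?f x) (@?g x)) =>
      refine (polyf_bool2 (f := f) (g := g) andb _ _); polyf_tac
  | |- polyf _ (fun x => orb (@?f x) (@?g x)) =>
      refine (polyf_bool2 (f := f) (g := g) orb _ _); polyf_tac
  | |- polyf _ (fun x => addb (@?f x) (@?g x)) =>
      refine (polyf_bool2 (f := f) (g := g) addb _ _); polyf_tac
  | |- polyf _ (fun x => negb (@?f x)) =>
      refine (polyf_bool (f := f) negb _); polyf_tac
  | |- polyf _ (fun x => case_seq (@?s x) (@?g x) (@?f x)) =>
      refine (polyf_case_seq (s := s) (g := g) (f := fun p x => f x p) _ _ _); polyf_tac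
  | |- polyf _ (fun x => case_option (@?s x) (@?g x) (@?f x)) =>
      refine (polyf_case_option (s := s) (g := g) (f := fun p x => f x p) _ _ _); polyf_tac
  | |- polyf _ (fun x => case_sum (@?s x) (@?f x) (@?g x)) =>
      refine (polyf_case_sum (s := s)
        (f := fun p x => f x p) (g := fun p x => g x p) _ _ _); polyf_tac
  | |- polyf _ (fun x => ?k (@?f x)) => polyf_call; polyf_tac
  | |- polyf _ (fun x => ?k (@?f x) (@?g x)) => polyf_call; polyf_tac
  | |- polyf _ _ =>
      solve [exact: polyf_fst | exact: polyf_snd | assumption | auto with polyf nocore]
  end.

Lemma sz_bool_le (b : bool) : sz b <= 3. Proof. by case: b. Qed.

Lemma sz_Some (A : enc_type) (a : A) : sz (Some a) = (sz a).+2.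
Proof. by []. Qed.

Section Lists.
Variables (I : finType) (A : enc_type).

Lemma polyf_catrev : polyf I (fun p : seq A * seq A => catrev p.1 p.2).
Proof.
apply: (@eq_polyf _ _ _ (fun p : seq A * seq A => foldl (fun s a => a :: s) p.2 p.1)).
  by case=> l s /=; elim: l s => //= a l IH s; rewrite IH.
apply: (polyf_foldl (g := fun s a p => a :: s) (K := fun n => n + 1)); try polyf_tac.
- by poly_bound.
- by move=> m n; rewrite leq_add2r.
- by move=> s a x; rewrite sz_cons; lia.
Qed.

Lemma polyf_rev : polyf I (@rev A).
Proof. by apply: (polyf_comp (f := fun l => (l, [::])) polyf_catrev); polyf_tac. Qed.

End Lists.

#[export] Hint Resolve polyf_catrev polyf_rev : polyf.

Lemma polyf_map (I : finType) (A B X : enc_type) (l : X -> seq A) (f : A -> X -> B) :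
  polyf I l -> polyf I (fun p => f p.1 p.2) -> polyf I (fun x => [seq f a x | a <- l x]).
Proof.
move=> pl pf; have [_ [p [bp mp sp _]]] := polyf_elim pf.
apply: (@eq_polyf _ _ _ (fun x => rev (foldl (fun s a => f a x :: s) [::] (l x)))).
  move=> x; rewrite -[RHS]revK /rev; congr catrev.
  by elim: (l x) [::] => //= a m IH s; rewrite IH.
apply: (polyf_comp (@polyf_rev I B)).
apply: (polyf_foldl (g := fun s a x => f a x :: s) (K := fun n => p (n + 1) + 1)) => //.
- by polyf_tac.
- apply: polyf_cons; last by polyf_tac.
  by apply: (polyf_comp (g := fun p => f p.1 p.2) (f := fun p => (p.1.2, p.2))) => //; polyf_tac.
- by poly_bound.
- by move=> m n mn; rewrite leq_add2r; apply: mp; rewrite leq_add2r.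
- move=> s a x; rewrite sz_cons; have := sp (a, x); rewrite sz_pair /=.
  by have := mp (sz a + sz x).+1 (sz a + sz x + 1); lia.
Qed.

(** * Binary arithmetic *)

Definition nat_of_bits (s : seq bool) : nat := foldr (fun (b : bool) m => b + m.*2) 0 s.

Fixpoint ripple (c : bool) (s : seq bool) : seq bool :=
  if s is b :: s' then (c (+) b) :: ripple (c && b) s' else if c then [:: true] else [::].

(** The carry of a full adder; with the first argument negated, the borrow of a full subtractor. *)
Definition majority (a b c : bool) := (a && b) || (c && (a || b)).

Fixpoint add_carry (c : bool) (s t : seq bool) : seq bool :=
  if s is a :: s' then
    (a (+) head false t (+) c) :: add_carry (majority a (head false t) c) s' (behead t)
  else ripple c t.

(* The first component is the final borrow. *)
Fixpoint sub_borrow (c : bool) (s t : seq bool) : bool * seq bool :=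
  if s is a :: s' then
    let r := sub_borrow (majority (~~ a) (head false t) c) s' (behead t) in
    (r.1, (a (+) head false t (+) c) :: r.2)
  else (c || has id t, [::]).

Definition add_bits := add_carry false.

(** A final borrow signals a negative difference, which truncated subtraction replaces by 0. *)
Definition sub_bits (s t : seq bool) : seq bool :=
  let r := sub_borrow false s t in if r.1 then [::] else r.2.

Lemma nat_of_ripple c s : nat_of_bits (ripple c s) = c + nat_of_bits s.
Proof. by elim: s c => [|b s IH] c; [case: c|rewrite /= IH; case: b c => [] []; lia]. Qed.

Lemma nat_of_behead t : nat_of_bits t = head false t + (nat_of_bits (behead t)).*2.
Proof. by case: t. Qed.

Lemma nat_of_add_carry c s t :
  nat_of_bits (add_carry c s t) = c + nat_of_bits s + nat_of_bits t.
Proof.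
elim: s c t => [|a s IH] c t /=; first by rewrite nat_of_ripple addn0.
by rewrite IH (nat_of_behead t); move: (head false t) => b; case: a b c => [] [] [];
   rewrite /=; lia.
Qed.

Lemma nat_of_bits0 t : (nat_of_bits t == 0) = ~~ has id t.
Proof. by elim: t => //= -[] t; rewrite ?double_eq0 // add0n double_eq0 => ->. Qed.

Lemma nat_of_sub_borrow c s t : let r := sub_borrow c s t in
  if r.1 then nat_of_bits s < c + nat_of_bits t
  else nat_of_bits s == c + nat_of_bits t + nat_of_bits r.2.
Proof.
elim: s c t => [|a s IH] c t /=.
  rewrite -[has id t]negbK -nat_of_bits0 -lt0n.
  by case: c (nat_of_bits t) => [] [|m] //=; lia.
rewrite (nat_of_behead t); move: (head false t) => b.
have := IH (majority (~~ a) b c) (behead t).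
by case: (sub_borrow _ _ _) => [[] u] /=; case: a b c => [] [] [] /=; lia.
Qed.

Lemma nat_of_sub_bits s t : nat_of_bits (sub_bits s t) = nat_of_bits s - nat_of_bits t.
Proof.
rewrite /sub_bits; have := nat_of_sub_borrow false s t; rewrite /= add0n.
by case: (sub_borrow _ _ _) => [[] u] /=; lia.
Qed.

Lemma size_ripple c s : size (ripple c s) <= (size s).+1.
Proof. by elim: s c => [|b s IH] [] //=; rewrite ltnS. Qed.

Lemma size_add_carry c s t : size (add_carry c s t) <= (maxn (size s) (size t)).+1.
Proof.
elim: s c t => [|a s IH] c t /=; first by rewrite max0n size_ripple.
by apply: leq_trans (IH _ _) _; case: t => [|b t] /=; lia.
Qed.

Lemma size_sub_bits s t : size (sub_bits s t) <= size s.
Proof.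
rewrite /sub_bits; suff h c : size (sub_borrow c s t).2 = size s.
  by case: ifP => // _; rewrite h.
by elim: s c t => //= a s IH c t; rewrite IH.
Qed.

(** Literal equality of digit strings, for comparing names of nonterminals. It is written as a fold
    so that [polyf_foldl] applies. *)
Definition eq_bits (s t : seq bool) : bool :=
  let r := foldl (fun (r : seq bool * bool) a =>
    case_seq r.1 ([::], false) (fun p => (p.2, r.2 && ~~ (a (+) p.1)))) (t, true) s in
  r.2 && case_seq r.1 true (fun=> false).

Lemma eq_bitsE s t : eq_bits s t = (s == t).
Proof.
rewrite /eq_bits; set f := fun r a => _.
suff h c : let r := foldl f (t, c) s in
    r.2 && case_seq r.1 true (fun=> false) = c && (s == t) by apply: h.
have bad u : (foldl f ([::], false) u).2 = false by elim: u.
elim: s t c => [|a s IH] [|b t] c //=; first by rewrite bad andbF.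
by rewrite IH /= eqseq_cons; case: a b c => [] [] [].
Qed.

Section BitPrograms.
Variable I : finType.

Lemma polyf_ripple : polyf I (fun p => ripple p.1 p.2).
Proof.
pose f (p : bool * seq bool) := foldl (fun (r : bool * seq bool) b =>
  (r.1 && b, (r.1 (+) b) :: r.2)) (p.1, [::]) p.2.
apply: (@eq_polyf _ _ _ (fun p => rev (case_bool (f p).1 (true :: (f p).2) (f p).2))).
  case=> c s; rewrite /f /=; set g := fun r b => _.
  suff h out : rev (case_bool (foldl g (c, out) s).1 (true :: (foldl g (c, out) s).2)
      (foldl g (c, out) s).2) = catrev out (ripple c s) by apply: h.
  by elim: s c out => [|b s IH] c out /=; [case: c|rewrite IH].
suff pf : polyf I f by polyf_tac.
(* A step adds one node and one digit of size at most 3 and replaces a Boolean by one of size at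
   most 3, whence 7. *)
apply: (polyf_foldl (i := fun p => (p.1, [::])) (g := fun (r : bool * seq bool) b x =>
  (r.1 && b, (r.1 (+) b) :: r.2)) (K := fun=> 7)); try polyf_tac.
- by poly_bound.
- by [].
- move=> [c out] b x /=; rewrite !sz_pair sz_cons.
  by have := sz_bool_le (c && b); have := sz_bool_le (c (+) b); lia.
Qed.
#[local] Hint Resolve polyf_ripple : polyf.

Lemma polyf_head_bits : polyf I (head false).
Proof.
by apply: (@eq_polyf _ _ _ (fun s => case_seq s false (fun p => p.1))); [case|polyf_tac].
Qed.

Lemma polyf_behead_bits : polyf I (@behead bool).
Proof.
by apply: (@eq_polyf _ _ _ (fun s => case_seq s [::] (fun p => p.2))); [case|polyf_tac].
Qed.

Lemma polyf_has_id : polyf I (has id).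
Proof.
apply: (@eq_polyf _ _ _ (fun s => foldl orb false s)).
  move=> s; rewrite -[RHS]orFb; elim: s false => [|b s IH] c /=; first by rewrite orbF.
  by rewrite IH orbA.
apply: (polyf_foldl (g := fun b c x => b || c) (K := fun=> 3)); try polyf_tac.
- by poly_bound.
- by [].
- by move=> b c x; have := sz_bool_le (b || c); lia.
Qed.
#[local] Hint Resolve polyf_head_bits polyf_behead_bits polyf_has_id : polyf.

Lemma polyf_add_bits : polyf I (fun p => add_bits p.1 p.2).
Proof.
pose f (p : seq bool * seq bool) := foldl (fun (r : bool * (seq bool * seq bool)) a =>
  (majority a (head false r.2.1) r.1,
   (behead r.2.1, (a (+) head false r.2.1 (+) r.1) :: r.2.2))) (false, (p.2, [::])) p.1.
apply: (@eq_polyf _ _ _ (fun p => catrev (f p).2.2 (ripple (f p).1 (f p).2.1))).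
  case=> s t; rewrite /f /add_bits /=; set g := fun r b => _.
  suff h c out : let r := foldl g (c, (t, out)) s in
    catrev r.2.2 (ripple r.1 r.2.1) = catrev out (add_carry c s t) by apply: h.
  by elim: s c t out => //= a s IH c t out; rewrite IH.
suff pf : polyf I f by polyf_tac.
apply: (polyf_foldl (i := fun p => (false, (p.2, [::])))
  (g := fun (r : bool * (seq bool * seq bool)) a x =>
  (majority a (head false r.2.1) r.1,
   (behead r.2.1, (a (+) head false r.2.1 (+) r.1) :: r.2.2))) (K := fun=> 7));
   try (rewrite /majority; polyf_tac).
- by poly_bound.
- by [].
- move=> [c [t out]] a x /=; rewrite !sz_pair sz_cons.
  move: (majority _ _ _) (_ (+) _ (+) _) => m d.
  have := sz_bool_le m; have := sz_bool_le d.
  by case: t => [|b t] /=; rewrite ?sz_cons; lia.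
Qed.

Lemma polyf_sub_bits : polyf I (fun p => sub_bits p.1 p.2).
Proof.
pose f (p : seq bool * seq bool) := foldl (fun (r : bool * (seq bool * seq bool)) a =>
  (majority (~~ a) (head false r.2.1) r.1,
   (behead r.2.1, (a (+) head false r.2.1 (+) r.1) :: r.2.2))) (false, (p.2, [::])) p.1.
apply: (@eq_polyf _ _ _ (fun p =>
    case_bool ((f p).1 || has id (f p).2.1) [::] (rev (f p).2.2))).
  case=> s t; rewrite /f /sub_bits /=; set g := fun r b => _.
  suff h c out : let r := foldl g (c, (t, out)) s in
      case_bool (r.1 || has id r.2.1) [::] (rev r.2.2) =
      if (sub_borrow c s t).1 then [::] else catrev out (sub_borrow c s t).2 by apply: h.
  by elim: s c t out => //= a s IH c t out; rewrite IH.
suff pf : polyf I f by polyf_tac.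
apply: (polyf_foldl (i := fun p => (false, (p.2, [::])))
  (g := fun (r : bool * (seq bool * seq bool)) a x =>
  (majority (~~ a) (head false r.2.1) r.1,
   (behead r.2.1, (a (+) head false r.2.1 (+) r.1) :: r.2.2))) (K := fun=> 7));
   try (rewrite /majority; polyf_tac).
- by poly_bound.
- by [].
- move=> [c [t out]] a x /=; rewrite !sz_pair sz_cons.
  move: (majority _ _ _) (_ (+) _ (+) _) => m d.
  have := sz_bool_le m; have := sz_bool_le d.
  by case: t => [|b t] /=; rewrite ?sz_cons; lia.
Qed.

Lemma polyf_eq_bits : polyf I (fun p => eq_bits p.1 p.2).
Proof.
pose f (p : seq bool * seq bool) := foldl (fun (r : seq bool * bool) a =>
    case_seq r.1 ([::], false) (fun p => (p.2, r.2 && ~~ (a (+) p.1)))) (p.2, true) p.1.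
apply: (@eq_polyf _ _ _ (fun p => (f p).2 && case_seq (f p).1 true (fun=> false))) => //.
suff pf : polyf I f by polyf_tac.
apply: (polyf_foldl (i := fun p => (p.2, true)) (g := fun (r : seq bool * bool) a x =>
  case_seq r.1 ([::], false) (fun p => (p.2, r.2 && ~~ (a (+) p.1)))) (K := fun=> 7));
   try polyf_tac.
- by poly_bound.
- by [].
- move=> [[|b t] c] a x /=; rewrite !sz_pair ?sz_cons; first
    by have := sz_gt0 c; rewrite /sz /=; lia.
  by have := sz_bool_le (c && ~~ (a (+) b)); lia.
Qed.

End BitPrograms.

#[export] Hint Resolve polyf_ripple polyf_has_id polyf_add_bits polyf_sub_bits
  polyf_eq_bits : polyf.

(** * Evaluation of grammars *)

Notation bits_pair := (seq bool * seq bool)%type.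
Notation value := (bits_pair * bits_pair)%type.
Notation symbol := (seq bool + letter unit)%type.
Notation raw_grammar := (seq bool * seq (seq symbol))%type.

Definition bits_pair_mul (x y : bits_pair) : bits_pair :=
  (add_bits x.1 (sub_bits y.1 x.2), add_bits y.2 (sub_bits x.2 y.1)).

Definition value_mul (x y : value) : value :=
  (bits_pair_mul x.1 y.1, bits_pair_mul x.2 y.2).

Definition value_one : value := (([::], [::]), ([::], [::])).

Definition value_letter (a : letter unit) : value :=
  case_sum a (fun _ => (([::], [:: true]), ([:: true], [::])))
             (fun _ => (([:: true], [::]), ([::], [:: true]))).

Definition value_omul (x y : option value) : option value :=
  case_option x None (fun v => case_option y None (fun w => Some (value_mul v w))).

(* The entry of the table [T] whose index has the binary representation [k]. *)
Definition lookup (T : seq (option value)) (k : seq bool) : option value :=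
  (foldl (fun (r : seq bool * option value) e =>
    (ripple true r.1, case_bool (eq_bits r.1 k) e r.2)) ([::], None) T).2.

Definition eval_symbol (T : seq (option value)) (x : symbol) : option value :=
  case_sum x (fun k => lookup T k) (fun a => Some (value_letter a)).

Definition eval_rhs (T : seq (option value)) (s : seq symbol) : option value :=
  foldl (fun o x => value_omul o (eval_symbol T x)) (Some value_one) s.

(** The outer fold uses [rules] as a counter of rounds; each round recomputes the whole table from
    the previous one. *)
Definition eval_rules (rules : seq (seq symbol)) : seq (option value) :=
  foldl (fun T (_ : seq symbol) => [seq eval_rhs T s | s <- rules]) [::] rules.

Definition all_defined (T : seq (option value)) : bool :=
  foldl (fun b e => case_option e false (fun=> b)) true T.

(** All entries must be defined, so that cycles unreachable from the start symbol are rejected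
    too. *)
Definition eval_table (T : seq (option value)) (k : seq bool) : option value :=
  case_bool (all_defined T) (lookup T k) None.

Definition eval_grammar (g : raw_grammar) : option value := eval_table (eval_rules g.2) g.1.

(** Subtraction can leave redundant high zeros, so numbers are compared by their truncated
    differences and not digit by digit. *)
Definition eq_num (s t : seq bool) : bool :=
  ~~ has id (sub_bits s t) && ~~ has id (sub_bits t s).

Definition eq_value (x y : value) : bool :=
  (eq_num x.1.1 y.1.1 && eq_num x.1.2 y.1.2) && (eq_num x.2.1 y.2.1 && eq_num x.2.2 y.2.2).

Definition same_value (g h : raw_grammar) : bool :=
  case_option (eval_grammar g) false (fun x =>
    case_option (eval_grammar h) false (fun y => eq_value x y)).

Definition width (o : option value) : nat :=
  if o is Some v then
    maxn (maxn (size v.1.1) (size v.1.2)) (maxn (size v.2.1) (size v.2.2))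
  else 0.

(** A sum has at most one digit more than its larger summand, and subtraction adds none. Hence the
    number of digits grows additively even where values double. *)
Lemma width_omul x y : width (value_omul x y) <= (maxn (width x) (width y)).+1.
Proof.
case: x y => [[[a b] [c d]]|] [[[a' b'] [c' d']]|] //=.
rewrite /add_bits.
have h s t u v : size s <= u -> size t <= v ->
    size (add_carry false s t) <= (maxn u v).+1.
  by move=> su tv; apply: leq_trans (size_add_carry _ _ _) _; lia.
have h1 := h _ _ _ _ (leqnn (size a)) (size_sub_bits a' b).
have h2 := h _ _ _ _ (leqnn (size b')) (size_sub_bits b a').
have h3 := h _ _ _ _ (leqnn (size c)) (size_sub_bits c' d).
have h4 := h _ _ _ _ (leqnn (size d')) (size_sub_bits d c').
by lia.
Qed.

Lemma sz_bits (s : seq bool) : size s < sz s <= 4 * size s + 1.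
Proof.
elim: s => // b s IH; rewrite sz_cons /=.
by have := sz_bool_le b; lia.
Qed.

Lemma width_sz o : sz o <= 16 * width o + 9.
Proof.
case: o => [[[a b] [c d]]|] //; rewrite sz_Some !sz_pair /=.
by have := sz_bits a; have := sz_bits b; have := sz_bits c; have := sz_bits d; lia.
Qed.

Lemma width_le_sz o : width o <= sz o.
Proof.
case: o => [[[a b] [c d]]|] //; rewrite sz_Some !sz_pair /=.
by have := sz_bits a; have := sz_bits b; have := sz_bits c; have := sz_bits d; lia.
Qed.

Lemma width_lookup T k m : all (fun o => width o <= m) T -> width (lookup T k) <= m.
Proof.
rewrite /lookup => hT; move: [::] => i.
have : width None <= m by [].
elim: T None i hT => [|e T IH] o i //= /andP[he hT] ho.
by apply: IH => //; rewrite /case_bool; case: ifP.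
Qed.

(** One digit per factor; the successor of [m] leaves room for terminals, which have width 1 even if
    [m] is 0. *)
Lemma width_eval_rhs T s m :
  all (fun o => width o <= m) T -> width (eval_rhs T s) <= m.+1 + size s.
Proof.
move=> hT; rewrite /eval_rhs.
suff h n o : m < n -> width o <= n ->
    width (foldl (fun o x => value_omul o (eval_symbol T x)) o s) <= n + size s by apply: h.
elim: s n o => [|x s IH] n o mn /= ho; first by rewrite addn0.
rewrite addnS -addSn; apply: IH; first exact: ltnW.
have hx : width (eval_symbol T x) <= n.
  case: x => [k|[|]] /=; [|lia..].
  by apply: leq_trans (width_lookup k hT) (ltnW mn).
by apply: leq_trans (width_omul _ _) _; lia.
Qed.

Lemma size_sz (A : enc_type) (s : seq A) : size s < sz s.
Proof. by elim: s => // a s IH; rewrite sz_cons /=; lia. Qed.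

Lemma all_width_sz T : all (fun o => width o <= sz T) T.
Proof.
suff h m : sz T <= m -> all (fun o => width o <= m) T by apply: h.
elim: T m => // o T IH m; rewrite sz_cons /= => hm; apply/andP; split.
  by apply: leq_trans (width_le_sz o) _; lia.
by apply: IH; lia.
Qed.

Lemma sz_table T m : all (fun o => width o <= m) T -> sz T <= size T * (16 * m + 10) + 1.
Proof.
elim: T => // o T IH /= /andP[ho hT]; rewrite sz_cons mulSn.
by have := width_sz o; have := IH hT; lia.
Qed.

Lemma sz_ripple c s : sz (ripple c s) <= sz s + c * 4.
Proof.
elim: s c => [|b s IH] c; first by case: c.
have := IH (c && b); rewrite /= !sz_cons.
by case: b c => [] [] /=; rewrite /sz /=; lia.
Qed.

Section EvalPrograms.
Variable I : finType.

Lemma polyf_value_mul : polyf I (fun p => value_mul p.1 p.2).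
Proof. by rewrite /value_mul /bits_pair_mul; polyf_tac. Qed.
#[local] Hint Resolve polyf_value_mul : polyf.

Lemma polyf_value_omul : polyf I (fun p => value_omul p.1 p.2).
Proof. by rewrite /value_omul; polyf_tac. Qed.

Lemma polyf_value_letter : polyf I value_letter.
Proof. by rewrite /value_letter; polyf_tac. Qed.
#[local] Hint Resolve polyf_value_omul polyf_value_letter : polyf.

Lemma polyf_lookup : polyf I (fun p => lookup p.1 p.2).
Proof.
rewrite /lookup; apply: (polyf_comp polyf_snd).
apply: (polyf_foldl (l := fst) (i := fun=> ([::], None))
  (g := fun (r : seq bool * option value) e p =>
    (ripple true r.1, case_bool (eq_bits r.1 p.2) e r.2)) (K := fun n => n + 5)).
- by polyf_tac.
- by polyf_tac.
- by polyf_tac.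
- by poly_bound.
- by move=> m n; rewrite leq_add2r.
- move=> [i o] e [T k] /=; rewrite !sz_pair /case_bool; have := sz_ripple true i; rewrite mul1n.
  by case: ifP => _; lia.
Qed.
#[local] Hint Resolve polyf_lookup : polyf.

Lemma polyf_eval_symbol : polyf I (fun p => eval_symbol p.1 p.2).
Proof. by rewrite /eval_symbol; polyf_tac. Qed.
#[local] Hint Resolve polyf_eval_symbol : polyf.

Lemma polyf_eval_rhs : polyf I (fun p => eval_rhs p.1 p.2).
Proof.
apply: (polyf_foldl_bounded (l := snd) (i := fun=> Some value_one)
  (g := fun o x p => value_omul o (eval_symbol p.1 x))
  (P := fun n => 16 * (n + n) + 9)).
- by polyf_tac.
- by polyf_tac.
- by polyf_tac.
- by poly_bound.
- case=> T s k; apply: leq_trans (width_sz _) _; rewrite leq_add2r leq_mul2l.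
  apply: leq_trans (width_eval_rhs (take k s) (all_width_sz T)) _.
  apply: (@leq_trans ((sz T).+1 + sz s)); last by rewrite sz_pair; lia.
  rewrite leq_add2l; apply: leq_trans (ltnW (size_sz s)).
  by rewrite size_take_min geq_minr.
Qed.
#[local] Hint Resolve polyf_eval_rhs : polyf.

(** Each round widens the entries by at most one plus the length of a right-hand side, so after [k]
    rounds the width is at most [k * (sz rules + 1)]. *)
Lemma polyf_eval_rules : polyf I eval_rules.
Proof.
apply: (polyf_foldl_bounded (l := id) (i := fun=> [::])
  (g := fun T _ rules => [seq eval_rhs T s | s <- rules])
  (P := fun n => n * (16 * (n * (n + 1)) + 10) + 1)).
- by polyf_tac.
- by polyf_tac.
- by apply: (polyf_map (l := snd) (f := fun s p => eval_rhs p.1.1 s)); polyf_tac.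
- by poly_bound.
- move=> rules k; set T := foldl _ _ _.
  have [sT wT] : size T <= size rules /\
      all (fun o => width o <= size (take k rules) * (sz rules + 1)) T.
    rewrite {}/T; elim/last_ind: (take k rules) => // l x [sT wT].
    rewrite foldl_rcons size_map size_rcons; split=> //.
    apply/allP => _ /mapP[s srules ->].
    apply: leq_trans (width_eval_rhs s wT) _.
    have le_s : sz s <= sz rules.
      elim: rules srules {sT wT} => // r rules IH; rewrite inE sz_cons.
      by case/orP=> [/eqP->|/IH]; lia.
    rewrite mulSn addSnnS addnC leq_add2r addn1 ltnS.
    exact: leq_trans (ltnW (size_sz s)) le_s.
  apply: leq_trans (sz_table wT) _; rewrite leq_add2r.
  have hr := size_sz rules.
  have hk : size (take k rules) <= size rules by rewrite size_take_min geq_minr.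
  apply: leq_mul; first exact: leq_trans sT (ltnW hr).
  by rewrite leq_add2r leq_mul2l leq_mul // ltnW // (leq_ltn_trans hk).
Qed.
#[local] Hint Resolve polyf_eval_rules : polyf.

Lemma polyf_all_defined : polyf I all_defined.
Proof.
apply: (polyf_foldl (l := id) (i := fun=> true)
  (g := fun b e (_ : seq (option value)) => case_option e false (fun=> b)) (K := fun=> 3)).
- by polyf_tac.
- by polyf_tac.
- by polyf_tac.
- by poly_bound.
- by [].
- by move=> b [v|] T /=; [exact: leq_addr|have := sz_bool_le false; lia].
Qed.
#[local] Hint Resolve polyf_all_defined : polyf.

Lemma polyf_eval_table : polyf I (fun p => eval_table p.1 p.2).
Proof. by rewrite /eval_table; polyf_tac. Qed.
#[local] Hint Resolve polyf_eval_table : polyf.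

Lemma polyf_eval_grammar : polyf I eval_grammar.
Proof. by rewrite /eval_grammar; polyf_tac. Qed.

Lemma polyf_eq_num : polyf I (fun p => eq_num p.1 p.2).
Proof. by rewrite /eq_num; polyf_tac. Qed.
#[local] Hint Resolve polyf_eval_grammar polyf_eq_num : polyf.

Lemma polyf_eq_value : polyf I (fun p => eq_value p.1 p.2).
Proof. by rewrite /eq_value; polyf_tac. Qed.
#[local] Hint Resolve polyf_eq_value : polyf.

Lemma polyf_same_value : polyf I (fun p => same_value p.1 p.2).
Proof. by rewrite /same_value; polyf_tac. Qed.

End EvalPrograms.
#[export] Hint Resolve polyf_same_value : polyf.

(** * Parsing *)

Notation tok := ((letter unit + bool) + option bool)%type.

Definition tok_of (t : token (letter unit)) : tok :=
  match t with
  | Terminal a => inl (inl a)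
  | Bit b => inl (inr b)
  | Nonterminal => inr None
  | Production => inr (Some true)
  | Separator => inr (Some false)
  end.

(* Tokens are parsed from right to left. A state holds the digits of an unfinished
   nonterminal, an unfinished right-hand side, the finished right-hand sides, and the
   grammar to the right of the separator, if the separator has been seen. *)
Notation parser_state :=
  (seq bool * (seq symbol * (seq (seq symbol) * option raw_grammar)))%type.

(** The start symbol is written first and hence read last: it remains as the only symbol of an
    unfinished right-hand side. *)
Definition finish (s : parser_state) : option raw_grammar :=
  case_seq s.1
    (case_seq s.2.1 None (fun p =>
      case_seq p.2 (case_sum p.1 (fun k => Some (k, s.2.2.1)) (fun=> None)) (fun=> None)))
    (fun=> None).

(** Pending digits admit only another digit or [Nonterminal]. The separator closes the right grammar
    and is accepted only once. *)
Definition parse_step (o : option parser_state) (t : tok) : option parser_state :=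
  case_option o None (fun s =>
    case_sum t
      (fun u => case_sum u
        (fun a => case_seq s.1 (Some ([::], (inr a :: s.2.1, s.2.2))) (fun=> None))
        (fun b => Some (b :: s.1, s.2)))
      (fun u => case_option u
        (Some ([::], (inl s.1 :: s.2.1, s.2.2)))
        (fun b => case_bool b
          (case_seq s.1 (Some ([::], ([::], (s.2.1 :: s.2.2.1, s.2.2.2)))) (fun=> None))
          (case_option s.2.2.2
            (case_option (finish s) None (fun g => Some ([::], ([::], ([::], Some g)))))
            (fun=> None))))).

Definition initial_state : parser_state := ([::], ([::], ([::], None))).

Definition parse_result (o : option parser_state) : option (raw_grammar * raw_grammar) :=
  case_option o None (fun s => case_option s.2.2.2 None (fun h =>
    case_option (finish s) None (fun g => Some (g, h)))).

Definition decide (l : seq tok) : bool :=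
  case_option (parse_result (foldl parse_step (Some initial_state) l)) false
    (fun p => same_value p.1 p.2).

Section ParserPrograms.
Variable I : finType.

Lemma polyf_finish : polyf I finish.
Proof. by rewrite /finish; polyf_tac. Qed.
#[local] Hint Resolve polyf_finish : polyf.

Lemma polyf_parse_result : polyf I parse_result.
Proof. by rewrite /parse_result; polyf_tac. Qed.
#[local] Hint Resolve polyf_parse_result : polyf.

Lemma polyf_parse_step : polyf I (fun p => parse_step p.1 p.2).
Proof. by rewrite /parse_step; polyf_tac. Qed.
#[local] Hint Resolve polyf_parse_step : polyf.

Lemma sz_finish s : sz (finish s) <= sz s.
Proof.
case: s => -[|b l] [[|x [|y syms]] [rules o]]; try exact: sz_gt0.
by case: x => [k|a]; [rewrite sz_Some !sz_pair sz_cons /sz /=; lia|exact: sz_gt0].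
Qed.

Lemma sz_parse_step o t : sz (parse_step o t) <= sz o + (sz t + 20).
Proof.
have none : sz (None : option parser_state) <= sz o + (sz t + 20).
  by rewrite /sz /=; lia.
case: o none => [[l [syms [rules o]]]|] none; last exact: none.
case: t none => [[a|b]|[[|]|]] none.
- case: l none => [|b l] none; last exact: none.
  rewrite /parse_step /= !sz_Some !sz_pair sz_cons.
  have -> : sz (inr a : symbol) = (sz a + 3).+1 by rewrite addnC.
  have -> : sz (inl (inl a) : tok) = (sz a + 2).+2 by rewrite /sz /=; lia.
  lia.
- by rewrite /parse_step /= !sz_Some !sz_pair sz_cons; rewrite /sz /=; lia.
- case: l none => [|b l] none; last exact: none.
  rewrite /parse_step /= !sz_Some !sz_pair sz_cons /sz /=; lia.
- case: o none => [g|] none; first exact: none.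
  rewrite /parse_step /=; case e: (finish _) => [g|]; last exact: none.
  have := sz_finish (l, (syms, (rules, None))); rewrite e !sz_Some !sz_pair.
  by rewrite /sz /=; lia.
- rewrite /parse_step /= !sz_Some !sz_pair sz_cons.
  have -> : sz (inl l : symbol) = (sz l).+2 by [].
  have -> : sz ([::] : seq bool) = 1 by [].
  by lia.
Qed.

Lemma polyf_decide : polyf I decide.
Proof.
rewrite /decide.
have ph : polyf I (foldl parse_step (Some initial_state)).
  apply: (polyf_foldl (l := id) (i := fun=> Some initial_state)
    (g := fun o t _ => parse_step o t) (K := fun n => n + 20)).
  - by polyf_tac.
  - by polyf_tac.
  - by polyf_tac.
  - by poly_bound.
  - by move=> m n; rewrite leq_add2r.
  - by move=> o t x; have := sz_parse_step o t; lia.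
by polyf_tac.
Qed.

End ParserPrograms.

(** * Parsing as the inverse of printing *)

Notation terminal := (letter unit).
Notation tokens := (seq (token terminal)).

Definition print_symbol (x : symbol) : tokens :=
  match x with inl k => Nonterminal :: map Bit k | inr a => [:: Terminal a] end.

Definition print_rhs (s : seq symbol) : tokens :=
  Production :: flatten (map print_symbol s).

Definition print_grammar (g : raw_grammar) : tokens :=
  (Nonterminal :: map Bit g.1) ++ flatten (map print_rhs g.2).

(** The parser invariant: a state determines the suffix of the input already read. *)
Definition state_tokens (s : parser_state) : tokens :=
  map Bit s.1 ++ flatten (map print_symbol s.2.1) ++ flatten (map print_rhs s.2.2.1) ++
  (if s.2.2.2 is Some g then Separator :: print_grammar g else [::]).

Definition parse (o : option parser_state) (w : tokens) : option parser_state :=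
  foldr (fun t o => parse_step o (tok_of t)) o w.

Lemma parse_cat o v w : parse o (v ++ w) = parse (parse o w) v.
Proof. exact: foldr_cat. Qed.

Lemma foldl_parse w : foldl parse_step (Some initial_state) (rev (map tok_of w)) =
  parse (Some initial_state) w.
Proof. by rewrite foldl_rev foldr_map. Qed.

Lemma finish_sound s g : finish s = Some g ->
  map Bit s.1 ++ flatten (map print_symbol s.2.1) ++ flatten (map print_rhs s.2.2.1) =
  print_grammar g.
Proof.
case: s => -[|b l] [[|[k|a] [|y syms]] [rules o]] //= [<-].
by rewrite /print_grammar /= cats0.
Qed.

Lemma parse_step_sound s t s' :
  parse_step (Some s) (tok_of t) = Some s' -> state_tokens s' = t :: state_tokens s.
Proof.
case: s => l [syms [rules o]]; rewrite /state_tokens.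
case: t => [a|b|||] /=; rewrite /parse_step /=.
- by case: l => //= -[<-].
- by case=> <-.
- by case=> <-; rewrite /= -catA.
- by case: l => //= -[<-]; rewrite /= -catA.
- case: o => //=; case e: finish => [g|] //= [<-] /=.
  by rewrite cats0 -(finish_sound e).
Qed.

Lemma parse_sound w s : parse (Some initial_state) w = Some s -> state_tokens s = w.
Proof.
elim: w s => [|t w IH] s /=; first by case=> <-.
by case: (parse _ w) IH => // s0 /(_ _ erefl) <-; apply: parse_step_sound.
Qed.

Lemma parse_result_sound w g h :
  parse_result (parse (Some initial_state) w) = Some (g, h) ->
  w = print_grammar g ++ Separator :: print_grammar h.
Proof.
case e: parse => [s|] //; have <- := parse_sound e.
rewrite /parse_result /case_option /state_tokens.
case: s {e} => l [syms [rules [h'|]]] //=; case ef: (finish _) => [g'|] // [<- <-].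
by rewrite -[RHS]/(print_grammar g' ++ _) -(finish_sound ef) -!catA.
Qed.

Lemma parse_bits l s k : parse (Some (l, s)) (map Bit k) = Some (k ++ l, s).
Proof. by elim: k => //= b k ->. Qed.

Lemma parse_symbols syms r s :
  parse (Some ([::], (syms, r))) (flatten (map print_symbol s)) = Some ([::], (s ++ syms, r)).
Proof.
elim: s => //= x s IH; rewrite parse_cat IH.
by case: x => [k|a] //=; rewrite parse_bits cats0.
Qed.

Lemma parse_rules rules o f :
  parse (Some ([::], ([::], (rules, o)))) (flatten (map print_rhs f)) =
  Some ([::], ([::], (f ++ rules, o))).
Proof. by elim: f => //= s f IH; rewrite parse_cat IH parse_symbols cats0. Qed.

Lemma parse_grammar o g : parse (Some ([::], ([::], ([::], o)))) (print_grammar g) =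
  Some ([::], ([:: inl g.1], (g.2, o))).
Proof. by rewrite parse_cat parse_rules /= parse_bits !cats0. Qed.

Lemma parse_complete g h :
  parse_result (parse (Some initial_state) (print_grammar g ++ Separator :: print_grammar h)) =
  Some (g, h).
Proof.
have sep : parse (Some initial_state) (Separator :: print_grammar h) =
    Some ([::], ([::], ([::], Some h))).
  rewrite -[LHS]/(parse_step (parse (Some initial_state) (print_grammar h)) (inr (Some false))).
  by rewrite parse_grammar /parse_step /= -surjective_pairing.
by rewrite parse_cat sep parse_grammar /parse_result /= -!surjective_pairing.
Qed.

(** * Correctness *)

Lemma pos_bits_succ p : pos_bits (Pos.succ p) = ripple true (pos_bits p).
Proof.
have id q : ripple false q = q by elim: q => //= b q ->.
by elim: p => [p /= ->|p _ /=|] //; rewrite id.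
Qed.

(** Allows [lookup] to number the table entries by incrementing a binary counter. *)
Lemma bits_succ i : bits i.+1 = ripple true (bits i).
Proof.
rewrite /bits; case: i => [|i] //.
have -> : bin_of_nat i.+2 = Npos (Pos.succ (pos_of_nat i i)).
  by apply: (can_inj nat_of_binK); rewrite bin_of_natK /= nat_of_succ_pos
    -[RHS]/((nat_of_bin (bin_of_nat i.+1)).+1) bin_of_natK.
by rewrite pos_bits_succ.
Qed.

Definition lookup_step k (r : seq bool * option value) e : seq bool * option value :=
  (ripple true r.1, case_bool (eq_bits r.1 k) e r.2).

Lemma lookup_notin T k j o : (forall i, i < size T -> k <> bits (j + i)) ->
  (foldl (lookup_step k) (bits j, o) T).2 = o.
Proof.
elim: T j o => //= e T IH j o hk; rewrite /lookup_step /= -bits_succ eq_bitsE.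
case: eqP => [e0|_] /=; first by case: (hk 0) => //; rewrite addn0.
by apply: IH => i iT; rewrite addSnnS; apply: hk.
Qed.

(** The fold keeps the last match, and by injectivity of [bits] no later index has the same name. *)
Lemma lookup_in T i j o : i < size T ->
  (foldl (lookup_step (bits (j + i))) (bits j, o) T).2 = nth None T i.
Proof.
elim: T i j o => //= e T IH [|i] j o iT; rewrite /lookup_step /= -bits_succ eq_bitsE.
  rewrite addn0 eqxx; apply: lookup_notin => i _ /bits_inj; lia.
by rewrite -addSnnS; apply: IH.
Qed.

Lemma lookup_bits T i : lookup T (bits i) = nth None T i.
Proof.
have [iT|Ti] := ltnP i (size T); first exact: (@lookup_in T i 0).
by rewrite nth_default //; apply: (@lookup_notin T _ 0) => k kT /bits_inj; lia.
Qed.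

Lemma lookup_Some T k v : lookup T k = Some v -> exists2 i, i < size T & k = bits i.
Proof.
move=> e; have [/hasP[i]|/hasPn h] := boolP (has (fun i => k == bits i) (iota 0 (size T))).
  by rewrite mem_iota => iT /eqP ->; exists i.
have : lookup T k = None.
  apply: (@lookup_notin T k 0) => i iT ki; have := h i; rewrite mem_iota iT.
  by move=> /(_ isT); rewrite ki eqxx.
by rewrite e.
Qed.

Definition value_nat (v : value) : (nat * nat) * (nat * nat) :=
  ((nat_of_bits v.1.1, nat_of_bits v.1.2), (nat_of_bits v.2.1, nat_of_bits v.2.2)).

Lemma value_nat_mul x y : value_nat (value_mul x y) = munn_mul (value_nat x) (value_nat y).
Proof.
by rewrite /value_nat /= /add_bits !nat_of_add_carry !nat_of_sub_bits.
Qed.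

Lemma value_nat_letter a : value_nat (value_letter a) = munn_letter a.
Proof. by case: a. Qed.

Lemma eq_numE s t : eq_num s t = (nat_of_bits s == nat_of_bits t).
Proof. by rewrite /eq_num -!nat_of_bits0 !nat_of_sub_bits; lia. Qed.

Lemma eq_valueE x y : eq_value x y = (value_nat x == value_nat y).
Proof. by rewrite /eq_value !eq_numE. Qed.

Definition munn_omul x y :=
  if x is Some a then if y is Some b then Some (munn_mul a b) else None else None.

Lemma munn_omulA : associative munn_omul.
Proof. by move=> [a|] [b|] [c|] //=; rewrite munn_mulA. Qed.

(** As [None] is absorbing, a sentential form has a value exactly when no nonterminal is left in
    it. *)
Definition form_munn n (s : seq ('I_n + terminal)) : option ((nat * nat) * (nat * nat)) :=
  foldr (fun x o => munn_omul (if x is inr a then Some (munn_letter a) else None) o)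
    (Some ((0, 0), (0, 0))) s.

Lemma form_munn_cat n (s t : seq ('I_n + terminal)) :
  form_munn (s ++ t) = munn_omul (form_munn s) (form_munn t).
Proof.
elim: s => [|x s IH] /=; first by case: form_munn => //= a; rewrite munn_mul1.
by rewrite IH munn_omulA.
Qed.

Lemma form_munn_terminals n (w : word) : form_munn (map (@inr 'I_n terminal) w) = Some (munn w).
Proof. by elim: w => //= a w ->. Qed.

Lemma form_munn_nonterm n (s : seq ('I_n + terminal)) X : inl X \in s -> form_munn s = None.
Proof.
elim: s => // x s IH; rewrite inE => /orP[/eqP<-//|/IH e] /=.
by rewrite -/(form_munn s) e; case: x.
Qed.

Definition raw_symbol n (x : 'I_n + terminal) : symbol :=
  match x with inl X => inl (bits X) | inr a => inr a end.

Definition raw_rules (g : grammar terminal) : seq (seq symbol) :=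
  [seq map (@raw_symbol _) (rhs g X) | X <- enum 'I_(nonterms g)].

Lemma size_raw_rules g : size (raw_rules g) = nonterms g.
Proof. by rewrite size_map size_enum_ord. Qed.

Lemma nth_raw_rules (g : grammar terminal) (X : 'I_(nonterms g)) :
  nth [::] (raw_rules g) X = map (@raw_symbol _) (rhs g X).
Proof. by rewrite (nth_map X) ?size_enum_ord // nth_ord_enum. Qed.

Definition raw (g : grammar terminal) : raw_grammar := (bits (start g), raw_rules g).

Lemma print_raw (g : grammar terminal) : print_grammar (raw g) = encode_grammar g.
Proof.
rewrite /print_grammar /encode_grammar /=; congr (_ :: (_ ++ flatten _)).
rewrite -map_comp; apply: eq_map => X /=; congr (_ :: flatten _).
by rewrite -map_comp; apply: eq_map => -[].
Qed.

Definition eval_round (rules : seq (seq symbol)) T := [seq eval_rhs T s | s <- rules].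

Lemma eval_rulesE rules : eval_rules rules = iter (size rules) (eval_round rules) [::].
Proof.
rewrite /eval_rules -/(eval_round rules); elim/last_ind: {2 3}rules => // l x IH.
by rewrite foldl_rcons size_rcons IH.
Qed.

Lemma value_nat_omul x y :
  omap value_nat (value_omul x y) = munn_omul (omap value_nat x) (omap value_nat y).
Proof. by case: x y => [x|] [y|] //=; rewrite value_nat_mul. Qed.

(** [F] stands for several rounds of parallel rewriting, of which only compatibility with
    concatenation and the fixing of terminals matter. *)
Lemma eval_rhs_form_munn n T (F : seq ('I_n + terminal) -> seq ('I_n + terminal)) s :
  (forall s t, F (s ++ t) = F s ++ F t) -> (forall a, F [:: inr a] = [:: inr a]) ->
  F [::] = [::] ->
  (forall X : 'I_n, omap value_nat (nth None T X) = form_munn (F [:: inl X])) ->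
  omap value_nat (eval_rhs T (map (@raw_symbol n) s)) = form_munn (F s).
Proof.
move=> Fcat Fterm F0 hT.
suff h o : omap value_nat (foldl (fun o x => value_omul o (eval_symbol T x)) o
    (map (@raw_symbol n) s)) = munn_omul (omap value_nat o) (form_munn (F s)).
  by rewrite [LHS]h; case: form_munn => //= a; rewrite munn_mul1.
elim: s o => [|x s IH] o /=.
  by rewrite F0; case: o => //= v; rewrite munn_mulx1.
rewrite IH value_nat_omul -munn_omulA -cat1s Fcat form_munn_cat.
congr (munn_omul _ (munn_omul _ _)).
case: x => [X|a] /=; first by rewrite lookup_bits hT.
by rewrite Fterm /= value_nat_letter munn_mulx1.
Qed.

(** Both sides unfold at the first rewriting step, from [X] to its right-hand side. For [k = 0] the
    table is empty and [X] is not rewritten, so both are undefined. *)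
Lemma eval_round_form_munn (g : grammar terminal) k (X : 'I_(nonterms g)) :
  omap value_nat (nth None (iter k (eval_round (raw_rules g)) [::]) X) =
  form_munn (iter k (@expand _ g) [:: inl X]).
Proof.
elim: k X => [|k IH] X; first by rewrite /= nth_nil.
rewrite iterS {1}/eval_round (nth_map [::]) ?size_raw_rules // nth_raw_rules iterSr.
have -> : expand [:: inl X] = rhs g X by rewrite /expand /= cats0.
apply: eval_rhs_form_munn => //.
- exact: iter_expand_cat.
- by move=> a; apply: (@iter_expand_terminal _ g k [:: a]).
- exact: (@iter_expand_terminal _ g k [::]).
Qed.

Lemma all_definedE T : all_defined T = all isSome T.
Proof.
rewrite /all_defined -[RHS]andTb; elim: T true => [|o T IH] b /=; first by rewrite andbT.
by rewrite IH; case: o => //=; rewrite andbF.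
Qed.

Lemma eval_grammar_raw (g : grammar terminal) :
  omap value_nat (eval_grammar (raw g)) =
  if [forall X, isSome (form_munn (iter (nonterms g) (@expand _ g) [:: inl X]))]
  then form_munn (iter (nonterms g) (@expand _ g) [:: inl (start g)]) else None.
Proof.
rewrite /eval_grammar /eval_table all_definedE eval_rulesE /case_bool /=.
rewrite size_raw_rules; set T := iter _ _ _.
have eT (X : 'I_(nonterms g)) :
    omap value_nat (nth None T X) = form_munn (iter (nonterms g) (@expand _ g) [:: inl X]).
  exact: eval_round_form_munn.
have sT : size T = nonterms g.
  (* The start symbol guarantees at least one round, after which the table has full length. *)
  have pos : 0 < nonterms g by case: (start g) => i /(leq_trans _) ->.
  by rewrite /T -{1}(prednK pos) /= size_map size_raw_rules.
have -> : all isSome T =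
    [forall X, isSome (form_munn (iter (nonterms g) (@expand _ g) [:: inl X]))].
  apply/(all_nthP None)/forallP => [h X|h i].
    by rewrite -eT; have := h X; rewrite sT => /(_ (ltn_ord X)); case: nth.
  rewrite sT => iN; have := h (Ordinal iN); rewrite -eT /=.
  by case: nth.
by case: ifP => // _; rewrite lookup_bits eT.
Qed.

(** One rewriting step leads from a nonterminal on a cycle to a form containing the next one, so
    some nonterminal survives every number of rounds. *)
Lemma iter_expand_acyclic (g : grammar terminal) :
  (forall X, isSome (form_munn (iter (nonterms g) (@expand _ g) [:: inl X]))) -> acyclic g.
Proof.
move=> total c c0; apply/negP => cyc.
suff nt k X : X \in c -> exists Y, inl Y \in iter k (@expand _ g) [:: inl X].
  case: c c0 nt {cyc} => // X c _ /(_ (nonterms g) X (mem_head _ _))[Y /form_munn_nonterm e].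
  by have := total X; rewrite e.
elim: k X => [|k IH] X Xc; first by exists X; rewrite inE.
have [Y hY] := IH _ (etrans (mem_next c X) Xc); exists Y.
have /splitPr e := next_cycle cyc Xc.
rewrite iterSr; have -> : expand [:: inl X] = rhs g X by rewrite /expand /= cats0.
case: e => s1 s2; rewrite iter_expand_cat -cat1s iter_expand_cat !mem_cat hY.
by rewrite orbT.
Qed.

Lemma acyclic_form_munn (A : slp terminal) X :
  form_munn (iter (nonterms A) (@expand _ A) [:: inl X]) =
  Some (munn (terminals (iter (nonterms A) (@expand _ A) [:: inl X]))).
Proof. by rewrite iter_expand_val form_munn_terminals -iter_expand_val. Qed.

Lemma eval_grammar_slp (A : slp terminal) :
  omap value_nat (eval_grammar (raw A)) = Some (munn (grammar_val A)).
Proof.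
rewrite eval_grammar_raw ifT ?acyclic_form_munn //.
by apply/forallP => X; rewrite acyclic_form_munn.
Qed.

Lemma eval_rhs_Some T s v : eval_rhs T s = Some v ->
  forall k, inl k \in s -> exists2 i, i < size T & k = bits i.
Proof.
rewrite /eval_rhs; elim: s (Some value_one) => // x s IH o /= e k.
rewrite inE => /orP[/eqP kx|]; last exact: IH e k.
move: e; rewrite -kx /=; case el: (lookup T k) => [w|]; first by move=> _; apply: lookup_Some el.
have -> : value_omul o None = None by case: o.
by elim: s {IH} => //= y s IH; move=> /IH.
Qed.

(** The default [x0] is taken only for strings that name no nonterminal. *)
Definition unraw_symbol n (x0 : 'I_n) (x : symbol) : 'I_n + terminal :=
  match x with
  | inl k => inl (odflt x0 [pick X : 'I_n | bits X == k])
  | inr a => inr a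
  end.

Lemma unraw_symbolK n (x0 : 'I_n) x :
  (forall k, x = inl k -> exists2 i, i < n & k = bits i) ->
  raw_symbol (unraw_symbol x0 x) = x.
Proof.
case: x => [k|a] // /(_ _ erefl)[i iN ->] /=.
case: pickP => [X /eqP e|/(_ (Ordinal iN))] /=; first by rewrite e.
by rewrite eqxx.
Qed.

(** A defined result means that every lookup succeeded, so every name is the binary form of the
    index of a rule. *)
Lemma eval_grammar_Some (r : raw_grammar) v : eval_grammar r = Some v ->
  exists g : grammar terminal, raw g = r.
Proof.
case: r => k rules; rewrite /eval_grammar /eval_table all_definedE eval_rulesE /case_bool /=.
case: ifP => // /allP def /lookup_Some[i iT ->].
have size_iter m : size (iter m (eval_round rules) [::]) <= size rules.
  by case: m => //= m; rewrite size_map.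
have iN := leq_trans iT (size_iter _).
have names s : s \in rules -> forall k, inl k \in s -> exists2 j, j < size rules & k = bits j.
  move=> srules k' k's; have pos : 0 < size rules by apply: leq_ltn_trans iN.
  (* The entries of the last table were computed from the table of the round before, so its lookups
     bound the names. *)
  have := def (eval_rhs (iter (size rules).-1 (eval_round rules) [::]) s).
  rewrite -{2}(prednK pos) iterS map_f // => /(_ isT).
  case e: eval_rhs => [w|] // _; have [j jT kj] := eval_rhs_Some e k's.
  by exists j => //; apply: leq_trans jT (size_iter _).
exists (@Grammar terminal (size rules) (Ordinal iN)
  [ffun X : 'I_(size rules) => map (unraw_symbol (Ordinal iN)) (nth [::] rules X)]).
rewrite /raw /raw_rules /=; congr pair.
apply: (@eq_from_nth _ [::]); rewrite size_map size_enum_ord // => j jN.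
rewrite (nth_map (Ordinal iN)) ?size_enum_ord // ffunE nth_enum_ord // -map_comp.
rewrite -[RHS]map_id; apply/eq_in_map => x xs /=; apply: unraw_symbolK => k' e.
by apply: (names (nth [::] rules j)); rewrite ?mem_nth // -e.
Qed.

Lemma eval_grammar_Some_slp (r : raw_grammar) v : eval_grammar r = Some v ->
  exists A : slp terminal, raw A = r.
Proof.
move=> e; have [g er] := eval_grammar_Some e.
have := eval_grammar_raw g; rewrite er e; case: forallP => // h _.
by exists (Slp (iter_expand_acyclic h)).
Qed.

(** If both values are defined, the parsed grammars come from straight-line programs, so a positive
    answer also certifies the encoding. Conversely, parsing recovers the grammars from their printed
    form. *)
Lemma decideP (w : tokens) : decide (rev (map tok_of w)) <->
  exists2 AB : slp terminal * slp terminal, encode_slp_pair AB = w & compressed_equal AB.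
Proof.
rewrite /decide foldl_parse; split.
  case e: parse_result => [[r s]|] //; have ew := parse_result_sound e; rewrite /same_value /=.
  case er: (eval_grammar r) => [x|] //=; case es: (eval_grammar s) => [y|] //=.
  rewrite eq_valueE => /eqP xy.
  have [A eA] := eval_grammar_Some_slp er; have [B eB] := eval_grammar_Some_slp es.
  exists (A, B); first by rewrite ew -eA -eB !print_raw.
  apply/fim_eqP; have := eval_grammar_slp A; have := eval_grammar_slp B.
  by rewrite eA eB er es /= xy => -[<-] [<-].
case=> -[A B] <- /fim_eqP AB.
rewrite /encode_slp_pair -!print_raw parse_complete /same_value /=.
have := eval_grammar_slp A; have := eval_grammar_slp B; rewrite -AB.
case: eval_grammar => // x [ex]; case: eval_grammar => //= y [ey].
by rewrite eq_valueE ex ey.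
Qed.

Theorem proposition1 :
  polytime_solvable (@encode_slp_pair (letter unit)) (@compressed_equal unit).
Proof.
apply: (polyf_decidable (tok := tok_of) (f := decide)); first exact: polyf_decide.
exact: decideP.
Qed.
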